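(* Let $\mathcal{A}=(A_1,\dots,A_k)$, where each $A_i=\{a_{i,1},\dots,a_{i,m_i}\}$ is a multi-subset of $\mathbb{Z}^n$ with $m_i\ge 2$, and let $S=(S_1,\dots,S_k)$ with $S_i\subseteq\{1,\dots,m_i\}$ be a choice of specialized coefficients. The tropicalization of the specialized resultant variety $\mathcal{R}_S(\mathcal{A})$ is the specialized tropical resultant $\mathcal{TR}_S(\mathcal{A})$.
   Context: Let $m=\sum_im_i$. Points in $A_i$ need not be distinct. Resultant variety: $\mathcal{R}(\mathcal{A})$ is the closure in $(\mathbb{C}^* )^m=\prod_i(\mathbb{C}^* )^{m_i}$ of the set of coefficient tuples $(c_{ij})$ for which the polynomials $f_i=\sum_jc_{ij}x^{a_{ij}}$ have a common zero in $(\mathbb{C}^* )^n$. Let $I$ be its ideal. Specialized resultant variety: let $K$ be the field of rational functions over $\mathbb{C}$ in parameters $\gamma_{ij}$, one for each $i$ and $j\in S_i$, and let $J$ be the ideal (over $K$) generated by $I$ and the binomials $c_{ij}-\gamma_{ij}$ for all $i$ and $j\in S_i$. Then $\mathcal{R}_S(\mathcal{A}):=V(J)\subseteq\prod_i(K^* )^{m_i}$. Tropicalization: for an ideal $J$, the support of its tropical variety is the set of $\omega\in\mathbb{R}^m$ such that $\mathrm{in}_\omega(J)$ (generated by the terms of smallest $\omega$-degree, disregarding any valuation on the field) contains no monomial. Tropical resultant: a tropical polynomial with support $A_i$ is $F_i(x)=\min_j(c_{ij}+a_{ij}\cdot x)$, $(c_{ij})_j\in\mathbb{R}^{m_i}$;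 $\mathcal{T}(F_i)\subseteq\mathbb{R}^n$ is the set of $x$ at which the minimum is attained by at least two indices. $\mathcal{TR}(\mathcal{A})\subseteq\mathbb{R}^m$ is the set of tuples $(F_1,\dots,F_k)$ with $\bigcap_i\mathcal{T}(F_i)\ne\emptyset$; it is the support of the tropicalization of $\mathcal{R}(\mathcal{A})$. Stable intersection: for supports $X_1,X_2\subseteq\mathbb{R}^m$ of locally balanced fans (pure fans such that the link at every codimension one face positively spans a linear subspace), the support of the stable intersection is $X_1\cap_{\mathrm{st}}X_2=\{\omega\in X_1\cap X_2:\mathrm{link}_\omega(X_1)-\mathrm{link}_\omega(X_2)=\mathbb{R}^m\}$, where $\mathrm{link}_\omega(X)=\{u:\exists\delta>0\ \forall\varepsilon\in(0,\delta):\omega+\varepsilon u\in X\}$ and the difference is the Minkowski difference $\{a-b\}$. Specialized tropical resultant: $U_S=\{x\in\mathbb{R}^m: x_{ij}=0\text{ for all }i\text{ and }j\in S_i\}$ and $\mathcal{TR}_S(\mathcal{A}):=\mathcal{TR}(\mathcal{A})\cap_{\mathrm{st}}U_S$. The assertion is an equality of supports in $\mathbb{R}^m$. *)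

(* Defs.v *)
(* The complex numbers are R[i], for R : realType. *)
From HB Require Import structures.
From mathcomp Require Import all_boot all_order all_algebra.
From mathcomp Require Import fraction complex.
From mathcomp Require Import boolp classical_sets reals.
From mathcomp Require Import mpoly.

Set Implicit Arguments.
Unset Strict Implicit.
Unset Printing Implicit Defensive.

Import Order.TTheory GRing.Theory Num.Theory.
Local Open Scope ring_scope.
Local Open Scope complex_scope.
Local Open Scope classical_set_scope.

Definition torus (F : fieldType) (d : nat) : set 'rV[F]_d :=
  [set c | forall t, c ord0 t != 0].

Definition vanishing_ideal (F : fieldType) (d : nat) (Z : set 'rV[F]_d) :
    set {mpoly F[d]} :=
  [set p | forall c, Z c -> p.@[fun t => c ord0 t] = 0].

(* Zariski closure inside the torus; the closed subsets of the torus are cut out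
   by polynomials, since a Laurent polynomial is a polynomial up to a unit. *)
Definition torus_closure (F : fieldType) (d : nat) (Z : set 'rV[F]_d) :
    set 'rV[F]_d :=
  [set c | torus c /\
     forall p : {mpoly F[d]}, vanishing_ideal Z p ->
       p.@[fun t => c ord0 t] = 0].

Definition ideal_span (A : comNzRingType) (G : set A) : set A :=
  [set p | exists s : seq (A * A),
     (forall u, u \in s -> G u.2) /\ p = \sum_(u <- s) u.1 * u.2].

Definition wdegree (R : realType) (d : nat) (w : 'rV[R]_d) (mu : 'X_{1..d}) : R :=
  \sum_t w ord0 t * (mu t)%:R.

(* Only exponents enter: any valuation on F is disregarded.  in_w(0) = 0. *)
Definition initial_form (R : realType) (F : fieldType) (d : nat) (w : 'rV[R]_d)
    (p : {mpoly F[d]}) : {mpoly F[d]} :=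
  \sum_(mu <- msupp p | all (fun nu => wdegree w mu <= wdegree w nu) (msupp p))
     p@_mu *: 'X_[mu].

Definition initial_ideal (R : realType) (F : fieldType) (d : nat) (w : 'rV[R]_d)
    (J : set {mpoly F[d]}) : set {mpoly F[d]} :=
  ideal_span [set initial_form w p | p in J].

Definition tropicalization (R : realType) (F : fieldType) (d : nat)
    (J : set {mpoly F[d]}) : set 'rV[R]_d :=
  [set w | ~ exists mu : 'X_{1..d}, initial_ideal w J 'X_[mu]].

Definition link (R : realType) (d : nat) (X : set 'rV[R]_d) (w : 'rV[R]_d) :
    set 'rV[R]_d :=
  [set u | exists2 delta : R, 0 < delta &
     forall e : R, 0 < e < delta -> X (w + e *: u)].

Definition minkowski_sub (R : realType) (d : nat) (X Y : set 'rV[R]_d) :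
    set 'rV[R]_d :=
  [set x - y | x in X & y in Y].

Definition stable_intersection (R : realType) (d : nat) (X Y : set 'rV[R]_d) :
    set 'rV[R]_d :=
  [set w | (X `&` Y) w /\ minkowski_sub (link X w) (link Y w) = setT].

(* The pairs (i, j), j < m i, are flattened to 'I_(\sum_i m i) by tagnat.Rank:
   the (i, j) coordinate of a row vector c is c ord0 (tagnat.Rank i j).
   The multiset A_i is the family j |-> a i j. *)
Section Resultants.
Variables (R : realType) (n k : nat) (m : 'I_k -> nat).
Variable a : forall i : 'I_k, 'I_(m i) -> 'rV[int]_n.
Variable S : forall i : 'I_k, {set 'I_(m i)}.

Definition laurent_monomial (x : 'rV[R[i]]_n) (e : 'rV[int]_n) : R[i] :=
  \prod_(l < n) x ord0 l ^ e ord0 l.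

Definition system_eval (c : 'rV[R[i]]_(\sum_i m i)) (i : 'I_k)
    (x : 'rV[R[i]]_n) : R[i] :=
  \sum_(j < m i) c ord0 (tagnat.Rank i j) * laurent_monomial x (a j).

Definition resultant_variety : set 'rV[R[i]]_(\sum_i m i) :=
  torus_closure [set c | torus c /\
    exists2 x, torus x & forall i, system_eval c i x = 0].

Definition resultant_ideal : set {mpoly R[i][\sum_i m i]} :=
  vanishing_ideal resultant_variety.

(* C(gamma_ij : j \in S i), with gamma_ij, for j the t-th element of S i, the
   variable of index tagnat.Rank i t. *)
Definition parameter_ring : idomainType := {mpoly R[i][\sum_i #|S i|]}.

Definition parameter_field : fieldType := {fraction parameter_ring}.

Definition parameter_const (z : R[i]) : parameter_field :=
  tofrac (z%:MP : parameter_ring).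

Definition gamma (i : 'I_k) (t : 'I_#|S i|) : parameter_field :=
  tofrac ('X_(tagnat.Rank (p_ := fun i => #|S i|) i t) : parameter_ring).

(* The ideal J of the specialized resultant variety V(J).  The tropicalization is
   that of J: the parameter field is not algebraically closed, so the points of
   V(J) over it do not determine J up to radical. *)
Definition specialized_ideal : set {mpoly parameter_field[\sum_i m i]} :=
  ideal_span
    ([set map_mpoly parameter_const p | p in resultant_ideal] `|`
     [set q | exists i (t : 'I_#|S i|),
        q = 'X_(tagnat.Rank i (enum_val t)) - (gamma t)%:MP]).

Definition tropical_term (w : 'rV[R]_(\sum_i m i)) (i : 'I_k) (x : 'rV[R]_n)
    (j : 'I_(m i)) : R :=
  w ord0 (tagnat.Rank i j) + \sum_(l < n) (a j ord0 l)%:~R * x ord0 l.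

Definition attains_min (w : 'rV[R]_(\sum_i m i)) (i : 'I_k) (x : 'rV[R]_n)
    (j : 'I_(m i)) : Prop :=
  forall j' : 'I_(m i), tropical_term w x j <= tropical_term w x j'.

Definition tropical_hypersurface (w : 'rV[R]_(\sum_i m i)) (i : 'I_k) :
    set 'rV[R]_n :=
  [set x | exists j1 j2 : 'I_(m i),
     [/\ j1 != j2, attains_min w x j1 & attains_min w x j2]].

Definition tropical_resultant : set 'rV[R]_(\sum_i m i) :=
  [set w | exists x, forall i, tropical_hypersurface w i x].

Definition specialization_subspace : set 'rV[R]_(\sum_i m i) :=
  [set w | forall i j, j \in S i -> w ord0 (tagnat.Rank i j) = 0].

Definition specialized_tropical_resultant : set 'rV[R]_(\sum_i m i) :=
  stable_intersection tropical_resultant specialization_subspace.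

End Resultants.

Arguments tropicalization R {F d} J _.
Arguments resultant_variety R {n k m} a _.
Arguments resultant_ideal R {n k m} a _.
Arguments specialized_ideal R {n k m} a S _.
Arguments tropical_resultant R {n k m} a _.
Arguments specialized_tropical_resultant R {n k m} a S _.

(* Main.v *)
(* Let T be the set of specialized indices.  If w does not vanish on T, in_w(J)
   contains a monomial because of the binomials.  If it does, then, clearing
   denominators, in_w(J) contains a monomial if and only if some Q in I has a
   w-initial form c^nu * g(c_T).

   If w is in the stable intersection there is no such Q: take v picking out a
   vertex of the Newton polytope of g and u in the link of TR(A) extending v; then
   w + e u is in TR(A) and Q has a single term of least weight, whereas every
   weight in TR(A) is realized by a curve of solvable systems.

   Conversely, if there is no such Q and v is any vector on T, the Laurent monomials
   c^mu with w.mu > 0, or with mu supported on T and v.mu > 0, span a nonunital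
   subring, not containing 1, of the ring of functions on the variety of all (c, x)
   with f_i(x) = 0.  By Chevalley's extension argument it is enlarged until, in each
   f_i, two terms have the smallest valuation.  The ensuing inequalities between
   exponents involve no negative combination, so that Farkas' lemma yields w in TR(A)
   and u in the link extending v. *)
Require Import Defs.
From HB Require Import structures.
From mathcomp Require Import all_boot all_order all_algebra.
From mathcomp Require Import fraction complex generic_quotient.
From mathcomp Require Import boolp classical_sets functions reals.
From mathcomp Require Import mpoly.
From mathcomp Require sequences exp.
From mathcomp Require Import ring lra.

Set Implicit Arguments.
Unset Strict Implicit.
Unset Printing Implicit Defensive.

Import Order.TTheory GRing.Theory Num.Theory.
Local Open Scope ring_scope.
Local Open Scope complex_scope.
Local Open Scope classical_set_scope.

(** * Extension of nonunital subrings *)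

Section Chevalley.
Variable B : comPzRingType.
Implicit Types (I : set B) (x y z : B).

Definition idealizer I : set B := [set f | forall g, I g -> I (f * g)].

Definition subrng I : Prop :=
  [/\ I 0, forall f g, I f -> I g -> I (f - g) &
      forall f g, I f -> I g -> I (f * g)].

Lemma subrngN I f : subrng I -> I f -> I (- f).
Proof. by case=> I0 IB _ If; rewrite -[- f]add0r; apply: IB. Qed.

Lemma subrngD I f g : subrng I -> I f -> I g -> I (f + g).
Proof.
move=> rI If Ig; rewrite -[g]opprK; case: (rI) => _ IB _.
by apply: IB => //; apply: subrngN.
Qed.

Lemma subrng_idealizer I : subrng I -> subrng (idealizer I).
Proof.
move=> rI; have [I0 IB IM] := rI; split=> [g Ig|f g If Ig h Ih|f g If Ig h Ih].
- by rewrite mul0r.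
- by rewrite mulrBl; apply: IB; [apply: If|apply: Ig].
- by rewrite -mulrA; apply/If/Ig.
Qed.

Lemma idealizer1 I : idealizer I 1.
Proof. by move=> g; rewrite mul1r. Qed.

Lemma sub_idealizer I : subrng I -> I `<=` idealizer I.
Proof. by case=> _ _ IM f If g Ig; apply: IM. Qed.

Definition truncated_adjoin I z n : set B :=
  [set f | exists2 c : nat -> B, (forall k, I (c k)) &
           f = \sum_(k < n) c k * z ^+ k].

Section TruncatedAdjoin.
Variables (I : set B) (rI : subrng I) (z : B).
Local Notation D := (truncated_adjoin I z).

Lemma truncated_adjoin0 n : D n 0.
Proof.
case: rI => I0 _ _; exists (fun=> 0) => //.
by rewrite big1 // => k _; rewrite mul0r.
Qed.

Lemma truncated_adjoinB n f g : D n f -> D n g -> D n (f - g).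
Proof.
move=> [c Ic ->] [d Id ->]; exists (fun k => c k - d k).
  by move=> k; case: rI => _ IB _; apply: IB.
by rewrite -sumrB; apply: eq_bigr => k _; rewrite mulrBl.
Qed.

Lemma truncated_adjoinD n f g : D n f -> D n g -> D n (f + g).
Proof.
move=> Df Dg; rewrite -[g]opprK; apply: truncated_adjoinB => //.
by rewrite -sub0r; apply: truncated_adjoinB => //; apply: truncated_adjoin0.
Qed.

Lemma truncated_adjoin_le m n f : (m <= n)%N -> D m f -> D n f.
Proof.
move=> /subnKC <- [c Ic ->]; exists (fun k => if (k < m)%N then c k else 0).
  by move=> k; case: ifP => // _; case: rI.
rewrite big_split_ord /= [X in _ = _ + X]big1 ?addr0 => [|k _].
  by apply: eq_bigr => k _; rewrite ltn_ord.
by rewrite ltnNge leq_addr mul0r.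
Qed.

Lemma truncated_adjoin_shift n f j : D n f -> D (j + n) (f * z ^+ j).
Proof.
move=> [c Ic ->]; exists (fun k => if (k < j)%N then 0 else c (k - j)%N).
  by move=> k; case: ifP => // _; case: rI.
rewrite big_split_ord /= [X in _ = X + _]big1 ?add0r => [|k _]; last first.
  by rewrite ltn_ord mul0r.
rewrite big_distrl /=; apply: eq_bigr => k _.
by rewrite ltnNge leq_addr /= addKn -mulrA -exprD addnC.
Qed.

Lemma truncated_adjoinS n f :
  D n.+1 f -> exists a g, [/\ I a, D n g & f = a + z * g].
Proof.
move=> [c Ic ->]; exists (c 0%N), (\sum_(k < n) c k.+1 * z ^+ k); split => //.
  by exists (fun k => c k.+1).
rewrite big_ord_recl expr0 mulr1 big_distrr /=; congr (_ + _).
by apply: eq_bigr => k _; rewrite exprS mulrCA.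
Qed.

Lemma truncated_adjoin_recr n f :
  D n.+1 f -> exists g a, [/\ D n g, I a & f = g + a * z ^+ n].
Proof.
move=> [c Ic ->]; rewrite big_ord_recr /=.
by exists (\sum_(k < n) c k * z ^+ k), (c n); split=> //; exists c.
Qed.

End TruncatedAdjoin.

Lemma truncated_adjoinM I K I' z n f c : I c ->
  (forall x y, I x -> K y -> I' (x * y)) ->
  truncated_adjoin K z n f -> truncated_adjoin I' z n (c * f).
Proof.
move=> Ic IKI' [d Kd ->]; exists (fun k => c * d k) => [k|]; first exact: IKI'.
by rewrite big_distrr /=; apply: eq_bigr => k _; rewrite mulrA.
Qed.

Lemma truncated_adjoin_rev I z z' n f : z * z' = 1 ->
  truncated_adjoin I z' n.+1 f -> truncated_adjoin I z n.+1 (z ^+ n * f).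
Proof.
move=> zz' [c Ic ->]; exists (fun k => c (n - k)%N) => //.
rewrite (reindex_inj rev_ord_inj) /= big_distrr /=; apply: eq_bigr => k _.
rewrite subSS mulrCA; congr (_ * _).
have lekn : (k <= n)%N by rewrite -ltnS.
by rewrite -{1}(subnKC lekn) exprD -mulrA -exprMn zz' expr1n mulr1.
Qed.

(* Both presentations of 1 are shortened in turn: the leading term of the longer
   one is eliminated by means of the other. *)
Lemma no_unit_presentations I y y' n m a f b g :
  subrng I -> ~ I 1 -> y * y' = 1 ->
  I a -> truncated_adjoin (idealizer I) y n f -> 1 = a + y * f ->
  I b -> truncated_adjoin I y' m g -> 1 = b + y' * g -> False.
Proof.
move=> rI nI1 yy'; have rA := subrng_idealizer rI.
have [I0 IB IM] := rI.
have y'y : y' * y = 1 by rewrite mulrC.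
have [N leN] := ubnP (n + m); elim: N => // N IHN in n m leN a f b g *.
case: n leN => [|n] leN Ia Df ea Ib Dg eb.
  case: Df ea => c _ ->; rewrite big_ord0 mulr0 addr0 => ea.
  by apply: nI1; rewrite ea.
case: m leN Dg eb => [|m] leN Dg eb.
  case: Dg eb => c _ ->; rewrite big_ord0 mulr0 addr0 => eb.
  by apply: nI1; rewrite eb.
have A1b x : I x -> idealizer I (1 - x).
  move=> Ix; case: rA => _ AB _; apply: AB; first exact: idealizer1.
  exact: sub_idealizer.
have [lemn|ltnm] := leqP m n.
- have [f1 [al [Df1 Aal ef]]] := truncated_adjoin_recr Df.
  have : truncated_adjoin I y n.+1 (al * (y ^+ m * g * y ^+ (n - m))).
    apply: (truncated_adjoinM Aal (K := I)) => [u v Au|]; first exact: Au.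
    rewrite -[n.+1](subnK (leqW lemn)) subSn // addSnnS.
    by apply: truncated_adjoin_shift => //; apply: (truncated_adjoin_rev yy').
  case/truncated_adjoinS => c0 [h [Ic0 Dh ec]].
  apply: (IHN n m.+1 _ (b + (1 - b) * a + c0) ((1 - b) * f1 + h) b g) => //.
  + by apply: subrngD => //; apply: subrngD => //; apply: A1b.
  + apply: truncated_adjoinD => //.
      apply: (truncated_adjoinM (A1b b Ib) _ Df1).
      by case: rA => _ _ AM; apply: AM.
    by case: Dh => d Id ->; exists d => // k; apply: sub_idealizer.
  + have eb' : 1 - b = y' * g by rewrite {1}eb; ring.
    have ey : (1 - b) * y ^+ n.+1 = y ^+ m * g * y ^+ (n - m).
      rewrite eb' -{1}[n](subnK lemn) exprS exprD.
      transitivity (y' * y * (g * y ^+ (n - m) * y ^+ m)); first by ring.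
      by rewrite y'y; ring.
    transitivity (b + (1 - b) * 1); first by ring.
    rewrite {2}ea ef.
    transitivity (b + (1 - b) * a + y * ((1 - b) * f1) + al * ((1 - b) * y ^+ n.+1)).
      by rewrite exprS; ring.
    by rewrite ey ec; ring.
- have [g1 [be [Dg1 Ibe eg]]] := truncated_adjoin_recr Dg.
  have : truncated_adjoin I y' m.+1 (be * (y' ^+ n * f * y' ^+ (m - n))).
    apply: (truncated_adjoinM Ibe (K := idealizer I)) => [u v Iu Av|].
      by rewrite mulrC; apply: Av.
    rewrite -[m.+1](subnK (leqW (ltnW ltnm))) subSn ?(ltnW ltnm) // addSnnS.
    by apply: truncated_adjoin_shift => //; apply: (truncated_adjoin_rev y'y).
  case/truncated_adjoinS => c0 [h [Ic0 Dh ec]].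
  have le' : (n.+1 + m < N)%N by rewrite addnS in leN.
  apply: (IHN n.+1 m le' a f (a + (1 - a) * b + c0) ((1 - a) * g1 + h)) => //.
  + by apply: subrngD => //; apply: subrngD => //; apply: A1b.
  + apply: truncated_adjoinD => //.
    apply: (truncated_adjoinM (A1b a Ia) _ Dg1).
    by move=> u v Au; apply: Au.
  + have ea' : 1 - a = y * f by rewrite {1}ea; ring.
    have ey : (1 - a) * y' ^+ m.+1 = y' ^+ n * f * y' ^+ (m - n).
      rewrite ea' -{1}[m](subnK (ltnW ltnm)) exprS exprD.
      transitivity (y * y' * (f * y' ^+ (m - n) * y' ^+ n)); first by ring.
      by rewrite yy'; ring.
    transitivity (a + (1 - a) * 1); first by ring.
    rewrite {2}eb eg.
    transitivity (a + (1 - a) * b + y' * ((1 - a) * g1) + be * ((1 - a) * y' ^+ m.+1)).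
      by rewrite exprS; ring.
    by rewrite ey ec; ring.
Qed.

Definition adjoin I z : set B := [set f | exists n, truncated_adjoin I z n f].

Lemma adjoin_shift I z f : subrng I -> adjoin I z f -> adjoin I z (z * f).
Proof.
by move=> rI [n Df]; exists (1 + n)%N; rewrite mulrC -[z]expr1; apply: truncated_adjoin_shift.
Qed.

Lemma adjoinM I K z f c : subrng I -> I c ->
  (forall x y, I x -> K y -> K (x * y)) -> adjoin K z f -> adjoin K z (c * f).
Proof. by move=> rI Ic IK [n Df]; exists n; apply: (truncated_adjoinM Ic IK Df). Qed.

Lemma subrng_adjoin I z : subrng I -> subrng (adjoin I z).
Proof.
move=> rI; have [I0 IB IM] := rI.
have DB : forall f g, adjoin I z f -> adjoin I z g -> adjoin I z (f - g).
  move=> f g [n Df] [m Dg]; exists (n + m)%N; apply: truncated_adjoinB => //.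
    by apply: truncated_adjoin_le Df => //; apply: leq_addr.
  by apply: truncated_adjoin_le Dg => //; apply: leq_addl.
have D0 : adjoin I z 0 by exists 0%N; apply: truncated_adjoin0.
split=> // f g [n [c Ic ->]] Dg; rewrite big_distrl /=.
elim/big_ind: _ => // [u v Du Dv|k _].
  by rewrite -[v]opprK; apply: (DB) => //; rewrite -sub0r; apply: DB.
rewrite -mulrA; apply: (adjoinM rI (Ic k)) => //.
elim: (k : nat) => [|j IHj]; first by rewrite expr0 mul1r.
by rewrite exprS -mulrA; apply: adjoin_shift.
Qed.

Lemma adjoin_inc I z : subrng I -> I `<=` adjoin I z.
Proof.
by move=> rI f If; exists 1%N, (fun=> f) => //; rewrite big_ord1 mulr1.
Qed.

Lemma chevalley_step I y y' : subrng I -> ~ I 1 -> y * y' = 1 ->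
  exists I', [/\ subrng I', ~ I' 1, I `<=` I', idealizer I `<=` idealizer I' &
                 idealizer I' y' \/ I' y].
Proof.
move=> rI nI1 yy'; have [I0 IB IM] := rI.
have rA := subrng_idealizer rI.
have [J1|nJ1] := pselect (adjoin I y' 1); last first.
  exists (adjoin I y'); split=> //.
  - exact: subrng_adjoin.
  - exact: adjoin_inc.
  - by move=> f Af g; apply: (adjoinM rA Af) => // u v Au; apply: Au.
  - by left=> g; apply: adjoin_shift.
have rAy := subrng_adjoin y rA.
have [Ay0 AyB AyM] := rAy.
pose I' := [set f | exists a g, [/\ I a, adjoin (idealizer I) y g & f = a + y * g]].
exists I'; split.
- split.
  + by exists 0, 0; split=> //; ring.
  + move=> _ _ [a [f [Ia Df ->]]] [b [g [Ib Dg ->]]].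
    by exists (a - b), (f - g); split; [apply: IB|apply: AyB|ring].
  + move=> _ _ [a [f [Ia Df ->]]] [b [g [Ib Dg ->]]].
    exists (a * b), (a * g + b * f + y * (f * g)); split; [exact: IM| |ring].
    apply: subrngD => //; last by apply: adjoin_shift => //; apply: AyM.
    by apply: subrngD => //; apply: AyM => //; apply: adjoin_inc => //; apply: sub_idealizer.
- case=> a [f [Ia [n Df] ea]]; case: J1 => -[|m].
    by case=> c _; rewrite big_ord0 => e10; apply: nI1; rewrite e10.
  move=> /truncated_adjoinS [b [g [Ib Dg eb]]].
  exact: (no_unit_presentations rI nI1 yy' Ia Df ea Ib Dg eb).
- by move=> f If; exists f, 0; split=> //; ring.
- move=> c Ac _ [a [f [Ia Df ->]]]; exists (c * a), (c * f); split; [exact: Ac| |ring].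
  by apply: AyM => //; apply: adjoin_inc.
- right; exists 0, 1; split=> //; last by ring.
  by apply: adjoin_inc => //; apply: idealizer1.
Qed.

Lemma chevalley (T : eqType) (ys : seq T) (y y' : T -> B) I :
  subrng I -> ~ I 1 -> (forall t, y t * y' t = 1) ->
  exists I', [/\ subrng I', ~ I' 1, I `<=` I', idealizer I `<=` idealizer I' &
                 forall t, t \in ys -> idealizer I' (y' t) \/ I' (y t)].
Proof.
move=> rI nI1 yy'; elim: ys I rI nI1 => [|t ys IHys] I rI nI1.
  by exists I; split.
have [I1 [r1 n1 s1 i1 h1]] := chevalley_step rI nI1 (yy' t).
have [I2 [r2 n2 s2 i2 h2]] := IHys I1 r1 n1.
exists I2; split=> // [|f Af|u].
- exact: subset_trans s2.
- exact/i2/i1.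
- rewrite inE => /orP[/eqP->|]; last exact: h2.
  by case: h1 => [/i2|/s2]; [left|right].
Qed.

End Chevalley.

(** * Farkas' lemma with natural coefficients *)

Inductive natural_cone (W : zmodType) (L : seq W) : W -> Prop :=
| natural_cone0 : natural_cone L 0
| natural_cone_in x : x \in L -> natural_cone L x
| natural_coneD x y : natural_cone L x -> natural_cone L y -> natural_cone L (x + y).

Section NaturalCone.
Variables (W : zmodType) (L : seq W).

Lemma natural_coneMn x n : natural_cone L x -> natural_cone L (x *+ n).
Proof.
move=> Lx; elim: n => [|n IHn]; first by rewrite mulr0n; apply: natural_cone0.
by rewrite mulrS; apply: natural_coneD.
Qed.

Lemma natural_cone_trans (L' : seq W) x :
  (forall y, y \in L' -> natural_cone L y) -> natural_cone L' x -> natural_cone L x.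
Proof.
move=> sub; elim=> [|y|y z _ Ly _ Lz]; first exact: natural_cone0.
  exact: sub.
exact: natural_coneD.
Qed.

End NaturalCone.

Section Farkas.
Variables (R : realFieldType) (V : finType).
Implicit Types (D : {ffun V -> int}) (z : V -> R).

Definition pairing D z : R := \sum_v (D v)%:~R * z v.

Lemma pairing0 z : pairing 0 z = 0.
Proof. by rewrite /pairing big1 // => v _; rewrite ffunE mul0r. Qed.

Lemma pairingD D D' z : pairing (D + D') z = pairing D z + pairing D' z.
Proof.
by rewrite -big_split; apply: eq_bigr => v _; rewrite ffunE rmorphD mulrDl.
Qed.

Lemma pairingN D z : pairing (- D) z = - pairing D z.
Proof. by rewrite -sumrN; apply: eq_bigr => v _; rewrite ffunE rmorphN mulNr. Qed.

Lemma pairingMn D z n : pairing (D *+ n) z = pairing D z *+ n.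
Proof.
elim: n => [|n IHn]; first by rewrite !mulr0n pairing0.
by rewrite !mulrS pairingD IHn.
Qed.

Lemma pairing_upd D z v t :
  pairing D (fun u => if u == v then t else z u)
  = pairing D z + (D v)%:~R * (t - z v).
Proof.
rewrite /pairing (bigD1 v) //= eqxx (bigD1 v (F := fun u => (D u)%:~R * z u)) //=.
rewrite (eq_bigr (fun u => (D u)%:~R * z u)) => [|u /negPf->//]; ring.
Qed.

Lemma between (lo hi : seq R) :
  (forall a b, a \in lo -> b \in hi -> a <= b) ->
  exists t, (forall a, a \in lo -> a <= t) /\ (forall b, b \in hi -> t <= b).
Proof.
move=> lohi.
have [u hu] : exists u, forall b, b \in hi -> u <= b.
  elim: hi {lohi} => [|b hi [u hu]]; first by exists 0.
  exists (Num.min b u) => c; rewrite inE ge_min => /orP[/eqP->|/hu->].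
    by rewrite lexx.
  by rewrite orbT.
elim: lo lohi => [|a lo IHlo] lohi; first by exists u; split.
have [t [ht1 ht2]] : exists t, (forall a, a \in lo -> a <= t) /\ (forall b, b \in hi -> t <= b).
  by apply: IHlo => c b lc; apply: lohi; rewrite inE lc orbT.
exists (Num.max a t); split=> [c|b hb].
  rewrite inE le_max => /orP[/eqP->|/ht1->]; last by rewrite orbT.
  by rewrite lexx.
by rewrite ge_max ht2 // lohi // mem_head.
Qed.

Local Notation con := ({ffun V -> int} * R)%type.
Local Notation affine l z := (l.2 + pairing l.1 z).

(* By Fourier-Motzkin elimination. *)
Lemma farkas_elim (vs : seq V) (L : seq ({ffun V -> int} * R)) :
  (forall l v, l \in L -> v \notin vs -> l.1 v = 0) ->
  (exists z, forall l, l \in L -> 0 <= affine l z) \/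
  (exists l, [/\ natural_cone L l, l.1 = 0 & l.2 < 0]).
Proof.
elim: vs L => [|v vs IHvs] L supp.
  have [Lpos|/allPn[l Ll]] := boolP (all (fun l => 0 <= l.2) L).
    left; exists (fun=> 0) => l Ll; rewrite /pairing big1 ?addr0 => [|u _].
      exact: (allP Lpos).
    by rewrite mulr0.
  rewrite -ltNge => l2; right; exists l; split=> //; first exact: natural_cone_in.
  by apply/ffunP => u; rewrite ffunE (supp l).
pose comb (p n : {ffun V -> int} * R) : {ffun V -> int} * R := p *+ `|n.1 v|%N + n *+ `|p.1 v|%N.
pose L' := [seq l : con <- L | l.1 v == 0] ++
  [seq comb p n | p <- [seq l : con <- L | 0 < l.1 v], n <- [seq l : con <- L | l.1 v < 0]].
have Mn1 (l : {ffun V -> int} * R) k : (l *+ k).1 = l.1 *+ k.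
  by elim: k => [|k IHk]; rewrite ?mulr0n // !mulrS /= IHk.
have Mn2 (l : {ffun V -> int} * R) k : (l *+ k).2 = l.2 *+ k.
  by elim: k => [|k IHk]; rewrite ?mulr0n // !mulrS /= IHk.
have L'P l : l \in L' ->
    (l \in L /\ l.1 v = 0) \/
    exists p n, [/\ p \in L, n \in L, 0 < p.1 v, n.1 v < 0 & l = comb p n].
  rewrite mem_cat mem_filter => /orP[/andP[/eqP l0 Ll]|]; first by left.
  case/allpairsP => -[p n] /=; rewrite !mem_filter => -[/andP[p0 Lp] /andP[n0 Ln] ->].
  by right; exists p, n.
have comb1 p n u : (comb p n).1 u = p.1 u *+ `|n.1 v|%N + n.1 u *+ `|p.1 v|%N.
  by rewrite /comb /= !Mn1 ffunE !ffunMnE.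
have [l u Ll' uvs|[z zL]|[l [Ll' l1 l2]]] := IHvs L'.
- have [eq_uv|neq_uv] := eqVneq u v.
    case/L'P: Ll' => [[_]|[p [n [_ _ p0 n0 ->]]]]; first by rewrite eq_uv.
    rewrite comb1 eq_uv -[X in X + _]mulr_natr -[X in _ + X]mulr_natr.
    rewrite !natz !abszE (gtr0_norm p0) (ltr0_norm n0); ring.
  have uvvs : u \notin v :: vs by rewrite inE negb_or neq_uv.
  case/L'P: Ll' => [[Ll _]|[p [n [Lp Ln _ _ ->]]]]; first exact: supp Ll uvvs.
  by rewrite comb1 (supp p _ Lp uvvs) (supp n _ Ln uvvs) !mul0rn addr0.
- pose rest (l : con) := affine l z - (l.1 v)%:~R * z v.
  pose bound (l : con) := - (rest l / (l.1 v)%:~R).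
  have [|t [tlo thi]] := @between [seq bound p | p : con <- L & 0 < p.1 v]
                                  [seq bound n | n : con <- L & n.1 v < 0].
    move=> _ _ /mapP[p + ->] /mapP[n + ->]; rewrite !mem_filter.
    move=> /andP[p0 Lp] /andP[n0 Ln].
    have /zL : comb p n \in L'.
      rewrite mem_cat; apply/orP; right; apply/allpairsP; exists (p, n).
      by rewrite !mem_filter p0 n0.
    have -> : affine (comb p n) z
        = affine p z * - (n.1 v)%:~R + affine n z * (p.1 v)%:~R.
      have mulabs (x : R) (k : int) : x *+ `|k|%N = x * `|k|%:~R.
        by rewrite -mulr_natr pmulrn abszE.
      rewrite /comb /= !Mn1 !Mn2 pairingD !pairingMn !mulabs.
      rewrite (gtr0_norm p0) (ltr0_norm n0) rmorphN /=; ring.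
    have a0 : 0 < (p.1 v)%:~R :> R by rewrite ltr0z.
    have b0 : 0 < - (n.1 v)%:~R :> R by rewrite oppr_gt0 ltrz0.
    rewrite /bound /rest; move: (affine p z) (affine n z) a0 b0 => x y.
    move: (p.1 v)%:~R (n.1 v)%:~R => {Lp Ln p0 n0} a b a0 b0 h.
    have an0 : a != 0 by rewrite gt_eqF.
    have bn0 : b != 0 by rewrite -oppr_eq0 gt_eqF.
    have -> : - ((x - a * z v) / a) = z v - x / a by field.
    have -> : - ((y - b * z v) / b) = z v + y / - b.
      by field.
    rewrite lerD2l -subr_ge0 opprK addrC.
    have -> : x / a + y / - b = (x * - b + y * a) / (a * - b).
      by field; rewrite ?an0 ?bn0.
    by rewrite divr_ge0 // ltW // mulr_gt0.
  left; exists (fun u => if u == v then t else z u) => l Ll.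
  rewrite pairing_upd.
  have -> : l.2 + (pairing l.1 z + (l.1 v)%:~R * (t - z v)) = rest l + (l.1 v)%:~R * t.
    by rewrite /rest; ring.
  have [l0|l0|l0] := ltrgt0P (l.1 v).
  + have : bound l <= t by apply/tlo/map_f; rewrite mem_filter l0.
    by rewrite /bound lerNl ler_pdivlMr ?ltr0z // mulNr -subr_ge0 opprK mulrC.
  + have : t <= bound l by apply/thi/map_f; rewrite mem_filter l0.
    by rewrite /bound lerNr ler_ndivrMr ?ltrz0 // mulNr -subr_ge0 opprK mulrC.
  + rewrite /rest l0 !mul0r subr0 addr0; apply: zL.
    by rewrite mem_cat mem_filter l0 eqxx Ll.
- right; exists l; split=> //; apply: natural_cone_trans Ll' => l' /L'P[[Ll' _]|].
    exact: natural_cone_in.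
  move=> [p [n [Lp Ln _ _ ->]]].
  by apply: natural_coneD; apply: natural_coneMn; apply: natural_cone_in.
Qed.

Lemma farkas_extension (P : pred V) (w : V -> R) (L : seq {ffun V -> int}) :
  (exists z, (forall v, P v -> z v = w v) /\ forall D, D \in L -> 0 <= pairing D z) \/
  (exists D, [/\ natural_cone L D, forall v, ~~ P v -> D v = 0 & pairing D w < 0]).
Proof.
pose r D : con := ([ffun v => if P v then 0 else D v], \sum_(v | P v) (D v)%:~R * w v).
have rD D D' : r (D + D') = r D + r D'.
  apply/pair_equal_spec; split.
    by apply/ffunP => v; rewrite !ffunE; case: ifP; rewrite ?addr0.
  by rewrite -big_split; apply: eq_bigr => v _; rewrite ffunE rmorphD mulrDl.
have r0 : r 0 = 0.
  apply/pair_equal_spec; split; first by apply/ffunP => v; rewrite !ffunE if_same.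
  by rewrite /= big1 // => v _; rewrite ffunE mul0r.
have [l v|[z zL]|[l [Ll l1 l2]]] := @farkas_elim (enum V) [seq r D | D <- L].
- by rewrite mem_enum.
- left; exists (fun v => if P v then w v else z v); split=> [v ->//|D LD].
  have /= := zL (r D) (map_f _ LD); rewrite /pairing [X in _ + X](bigID P) /=.
  rewrite [X in _ + (X + _)]big1 => [|v Pv]; last by rewrite ffunE Pv mul0r.
  rewrite add0r [X in _ -> 0 <= X](bigID P) /=.
  congr (0 <= _); congr (_ + _); apply: eq_bigr => v; first by move->.
  by move=> /negPf nP; rewrite ffunE nP.
- have [D [LD lD]] : exists D, natural_cone L D /\ l = r D.
    elim: Ll {l1 l2} => [|_ /mapP[D LD ->]|_ _ _ [D [LD ->]] _ [D' [LD' ->]]].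
    + by exists 0; split=> //; apply: natural_cone0.
    + by exists D; split=> //; apply: natural_cone_in.
    + by exists (D + D'); split; [apply: natural_coneD|rewrite rD].
  have D0 v : ~~ P v -> D v = 0.
    by move=> /negPf nP; move: l1; rewrite lD => /ffunP/(_ v); rewrite !ffunE nP.
  right; exists D; split=> //; rewrite /pairing (bigID P) /= [X in _ + X]big1 ?addr0.
    by rewrite lD in l2.
  by move=> v /D0->; rewrite mul0r.
Qed.

Lemma pairing_comb D z z' e :
  pairing D (fun v => z v + e * z' v) = pairing D z + e * pairing D z'.
Proof. by rewrite mulr_sumr -big_split; apply: eq_bigr => v _ /=; ring. Qed.

End Farkas.

(** * Weights in the tropical resultant *)

Local Notation expR := sequences.expR.

Section Exponentials.
Variable R : realType.

Lemma expRXz (x : R) (k : int) : expR x ^ k = expR (k%:~R * x).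
Proof.
case: k => k; first by rewrite -exprnP -exp.expRM_natl.
by rewrite NegzE -exprnN -exp.expRM_natl -exp.expRN rmorphN mulNr.
Qed.

Lemma expRN_le_inv (x : R) : 0 < x -> expR (- x) <= x^-1.
Proof.
move=> x0; rewrite exp.expRN lef_pV2 ?posrE ?exp.expR_gt0 //.
by apply: le_trans (exp.expR_ge1Dx x); rewrite lerDr.
Qed.

Lemma wdegreeD d (w : 'rV[R]_d) (mu nu : 'X_{1..d}) :
  wdegree w (mu + nu)%MM = wdegree w mu + wdegree w nu.
Proof.
by rewrite -big_split; apply: eq_bigr => t _; rewrite mnmDE natrD mulrDr.
Qed.

(* A term of strictly smallest weight dominates as s tends to infinity. *)
Lemma dominant_term d (w : 'rV[R]_d) (L : seq 'X_{1..d}) (q : 'X_{1..d} -> R)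
    (r : nat -> 'I_d -> R) (K : R) (l0 : 'X_{1..d}) :
  uniq L -> l0 \in L ->
  (forall l, l \in L -> l != l0 -> wdegree w l0 < wdegree w l) ->
  (forall s t, 1 <= `|r s t| <= K) ->
  (forall s, \sum_(l <- L) q l * \prod_t (r s t * expR (- (s%:R * w ord0 t))) ^+ l t = 0) ->
  q l0 = 0.
Proof.
move=> uL l0L minl0 rK sum0; apply: contrapT => /eqP q0.
have prodE s (l : 'X_{1..d}) : \prod_t (r s t * expR (- (s%:R * w ord0 t))) ^+ l t
    = (\prod_t r s t ^+ l t) * expR (- (s%:R * wdegree w l)).
  rewrite /wdegree mulr_sumr -sumrN exp.expR_sum -big_split; apply: eq_bigr => t _.
  by rewrite exprMn -exp.expRM_natr mulNr mulrA.
pose C l := `|q l| * (\prod_(t < d) K ^+ l t) * (wdegree w l - wdegree w l0)^-1.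
have bound (s : nat) : (0 < s)%N -> `|q l0| * s%:R <= \sum_(l <- rem l0 L) C l.
  move=> s0; have s0R : 0 < s%:R :> R by rewrite ltr0n.
  have := sum0 s; rewrite (perm_big _ (perm_to_rem l0L)) big_cons prodE.
  move=> /eqP; rewrite addr_eq0 => /eqP eq0.
  have e0 := exp.expR_gt0 (- (s%:R * wdegree w l0)).
  have le1 : `|q l0| * expR (- (s%:R * wdegree w l0)) <=
     `|q l0 * ((\prod_t r s t ^+ l0 t) * expR (- (s%:R * wdegree w l0)))|.
    rewrite !normrM (gtr0_norm e0) ler_wpM2l // ler_peMl ?(ltW e0) //.
    rewrite normr_prod; elim/big_ind: _ => // [x y|t _]; first exact: mulr_ege1.
    by rewrite normrX exprn_ege1 //; case/andP: (rK s t).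
  have /(le_trans le1) : `|q l0 * ((\prod_t r s t ^+ l0 t) * expR (- (s%:R * wdegree w l0)))|
     <= \sum_(l <- rem l0 L) C l * (expR (- (s%:R * wdegree w l0)) / s%:R).
    rewrite eq0 normrN; apply: le_trans (ler_norm_sum _ _ _) _.
    rewrite big_seq [X in _ <= X]big_seq; apply: ler_sum => l.
    rewrite (rem_filter l0 uL) mem_filter => /andP[/= nl0 lL].
    have dl := minl0 l lL nl0; rewrite -subr_gt0 in dl.
    rewrite prodE !normrM /C -!mulrA ler_wpM2l //; apply: ler_pM => //.
      rewrite normr_prod; apply: ler_prod => t _; rewrite normr_ge0 normrX /=.
      have /andP[_ leK] := rK s t.
      by apply: lerXn2r; rewrite ?nnegrE // (le_trans (normr_ge0 _) leK).
    rewrite gtr0_norm ?exp.expR_gt0 //.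
    have -> : - (s%:R * wdegree w l) =
       - (s%:R * (wdegree w l - wdegree w l0)) + - (s%:R * wdegree w l0) by ring.
    rewrite exp.expRD mulrCA mulrC ler_wpM2l ?(ltW e0) //.
    rewrite -invfM mulrC; apply: expRN_le_inv.
    by rewrite mulr_gt0.
  rewrite -big_distrl /= mulrA mulrAC ler_pM2r //.
  by rewrite ler_pdivlMr.
have C0 : 0 <= \sum_(l <- rem l0 L) C l.
  by have := bound 1%N isT; rewrite mulr1; apply: le_trans.
have := archi_boundP (divr_ge0 C0 (normr_ge0 (q l0))); set N := Num.bound _ => hN.
have := bound N.+1 isT; apply/negP; rewrite -ltNge -ltr_pdivrMl ?normr_gt0 // mulrC.
by apply: lt_trans hN _; rewrite ltr_nat.
Qed.

End Exponentials.

Section Blocks.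
Variables (k : nat) (m : 'I_k -> nat).
Local Notation M := (\sum_i m i)%N.

Definition block_fun (X : Type) (f : forall i, 'I_(m i) -> X) (t : 'I_M) : X :=
  f (tag (tagnat.sig t)) (tagged (tagnat.sig t)).

Lemma block_funE X (f : forall i, 'I_(m i) -> X) i (j : 'I_(m i)) :
  block_fun f (tagnat.Rank i j) = f i j.
Proof. by rewrite /block_fun /tagnat.Rank tagnat.rankK. Qed.

Lemma Rank_surj (t : 'I_M) : exists i (j : 'I_(m i)), t = tagnat.Rank i j.
Proof. by exists (tagnat.sig1 t), (tagnat.sig2 t); rewrite tagnat.sig2K. Qed.

End Blocks.

Section Resultant.
Variables (R : realType) (n k : nat) (m : 'I_k -> nat).
Variable a : forall i : 'I_k, 'I_(m i) -> 'rV[int]_n.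
Local Notation M := (\sum_i m i)%N.

Definition system_zero (c : 'rV[R[i]]_M) (x : 'rV[R[i]]_n) : Prop :=
  [/\ torus c, torus x & forall i, system_eval a c i x = 0].

Lemma resultant_idealP (Q : {mpoly R[i][M]}) :
  resultant_ideal R a Q <->
  forall c x, system_zero c x -> Q.@[fun t => c ord0 t] = 0.
Proof.
split=> [IQ c x [tc tx cx]|Q0 c [_ ]].
  by apply: IQ; split=> // p; apply; split=> //; exists x.
by apply => d [td [x tx dx]]; apply: (Q0 d x).
Qed.

Section Curve.
Variables (w : 'rV[R]_M) (x : 'rV[R]_n) (j1 : forall i, 'I_(m i)).

Definition curve_coef (s : nat) : 'I_M -> R :=
  block_fun (fun i j => if j == j1 i
    then - \sum_(j' | j' != j1 i)
             expR (- (s%:R * (tropical_term a w x j' - tropical_term a w x (j1 i))))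
    else 1).

Definition curve (s : nat) : 'rV[R[i]]_M :=
  \row_t (curve_coef s t * expR (- (s%:R * w ord0 t)))%:C.

Definition curve_root (s : nat) : 'rV[R[i]]_n :=
  \row_l (expR (- (s%:R * x ord0 l)))%:C.

Lemma laurent_monomial_curve s (e : 'rV[int]_n) :
  laurent_monomial (curve_root s) e =
  (expR (- (s%:R * \sum_l (e ord0 l)%:~R * x ord0 l)))%:C.
Proof.
rewrite mulr_sumr -sumrN exp.expR_sum rmorph_prod; apply: eq_bigr => l _.
by rewrite mxE -fmorphXz /= expRXz; congr (expR _)%:C; ring.
Qed.

Lemma system_eval_curve s i : system_eval a (curve s) i (curve_root s) = 0.
Proof.
have E j : curve s ord0 (tagnat.Rank i j) * laurent_monomial (curve_root s) (a j)
    = (curve_coef s (tagnat.Rank i j) * expR (- (s%:R * tropical_term a w x j)))%:C.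
  rewrite laurent_monomial_curve mxE -rmorphM /= -mulrA -exp.expRD.
  by congr (_ * expR _)%:C; rewrite /tropical_term; ring.
rewrite /system_eval (eq_bigr _ (fun j _ => E j)) -rmorph_sum /=.
rewrite -[RHS](rmorph0 (real_complex R)); congr _%:C.
rewrite (bigD1 (j1 i)) //= /curve_coef block_funE eqxx mulNr big_distrl /=.
apply/eqP; rewrite addrC subr_eq0; apply/eqP; apply: eq_bigr => j /negPf nj.
by rewrite block_funE nj mul1r -exp.expRD; congr expR; ring.
Qed.

Lemma curve_coef_bound : (forall i, tropical_hypersurface a w i x) ->
  (forall i, attains_min a w x (j1 i)) ->
  forall s t, 1 <= `|curve_coef s t| <= 1 + (\max_i m i)%:R.
Proof.
move=> xw j1min s t; have [i [j ->]] := Rank_surj t.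
rewrite /curve_coef block_funE.
case: ifP => _; last by rewrite normr1 lexx lerDl ler0n.
have term_ge0 (j' : 'I_(m i)) : 0 <= s%:R * (tropical_term a w x j' - tropical_term a w x (j1 i)).
  by apply: mulr_ge0 => //; rewrite subr_ge0; apply: j1min.
rewrite normrN ger0_norm; last by apply: sumr_ge0 => j' _; apply: exp.expR_ge0.
apply/andP; split.
  have [j2 nj2 j2min] : exists2 j2, j2 != j1 i & attains_min a w x j2.
    have [ja [jb [nab ha hb]]] := xw i.
    have [eqa|na] := eqVneq ja (j1 i); last by exists ja.
    by exists jb => //; rewrite -eqa eq_sym.
  rewrite (bigD1 j2) //=.
  have -> : tropical_term a w x j2 = tropical_term a w x (j1 i).
    by apply/eqP; rewrite eq_le; apply/andP; split; [apply: j2min|apply: j1min].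
  rewrite subrr mulr0 oppr0 exp.expR0 lerDl.
  by apply: sumr_ge0 => j' _; apply: exp.expR_ge0.
apply: le_trans (_ : (m i)%:R <= _); last first.
  by apply: ler_wpDl => //; rewrite ler_nat; apply: leq_bigmax.
apply: le_trans (_ : \sum_(j' | j' != j1 i) 1 <= _).
  by apply: ler_sum => j' _; rewrite exp.expR_le1 oppr_le0.
rewrite sumr_const ler_nat; apply: leq_trans (max_card _) _.
by rewrite card_ord.
Qed.

End Curve.

Lemma tropical_resultant_no_strict_min (w : 'rV[R]_M) (Q : {mpoly R[i][M]}) l0 :
  tropical_resultant R a w -> resultant_ideal R a Q -> l0 \in msupp Q ->
  (forall l, l \in msupp Q -> l != l0 -> wdegree w l0 < wdegree w l) -> False.
Proof.
case=> x xw /resultant_idealP Q0 l0Q minl0.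
have [j1 j1min] : exists j1 : forall i : 'I_k, 'I_(m i), forall i, attains_min a w x (j1 i).
  have ex i : exists j : 'I_(m i), attains_min a w x j by have [ja [_ [_ h _]]] := xw i; exists ja.
  by exists (fun i => projT1 (cid (ex i))) => i; case: (cid (ex i)).
have rK := curve_coef_bound xw j1min.
have zero s : Q.@[fun t => curve w x j1 s ord0 t] = 0.
  apply: (Q0 _ (curve_root x s)); split=> [t|l|i]; last exact: system_eval_curve.
    rewrite mxE (fmorph_eq0 (real_complex R)).
    apply: mulf_neq0; last by rewrite gt_eqF ?exp.expR_gt0.
    by have /andP[/(lt_le_trans ltr01) + _] := rK s t; rewrite normr_gt0.
  by rewrite mxE (fmorph_eq0 (real_complex R)) gt_eqF ?exp.expR_gt0.
have part (f : R[i] -> R) : (forall u v, f (u + v) = f u + f v) -> f 0 = 0 ->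
    (forall u (v : R), f (u * v%:C) = f u * v) -> f Q@_l0 = 0.
  move=> fD f0 fM; apply: (dominant_term (q := fun l => f Q@_l) (msupp_uniq Q) l0Q minl0 rK) => s.
  have := congr1 f (zero s); rewrite mevalE (big_morph f fD f0) f0 => e0.
  rewrite -[RHS]e0; apply: eq_bigr => l _; rewrite -fM rmorph_prod; congr (f (_ * _)).
  by apply: eq_bigr => t _; rewrite mxE rmorphXn.
have : Q@_l0 = 0.
  apply/eqP; rewrite eq_complex; apply/andP; split; apply/eqP; apply: part => //.
  - by move=> [? ?] [? ?].
  - by move=> [u1 u2] v /=; rewrite mulr0 subr0.
  - by move=> [? ?] [? ?].
  - by move=> [u1 u2] v /=; rewrite mulr0 add0r.
by move/eqP; rewrite mcoeff_eq0 l0Q.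
Qed.

End Resultant.

(** * Initial forms *)

Lemma seq_min (T : eqType) (le : T -> T -> Prop) (L : seq T) :
  (forall x y, le x y \/ le y x) -> (forall y x z, le x y -> le y z -> le x z) ->
  L != [::] -> exists2 x, x \in L & forall y, y \in L -> le x y.
Proof.
move=> tot tr; elim: L => // x L IHL _.
have le_refl y : le y y by case: (tot y y).
have [->|/IHL[y yL hy]] := eqVneq L [::].
  by exists x; rewrite ?mem_head // => y; rewrite inE => /eqP->.
have [le_xy|le_yx] := tot x y.
  exists x; rewrite ?mem_head // => z; rewrite inE => /orP[/eqP->//|/hy].
  exact: tr.
by exists y; rewrite ?inE ?yL ?orbT // => z; rewrite inE => /orP[/eqP->|/hy].
Qed.

Section WeightComponents.
Variables (R : realType) (F : fieldType) (d : nat) (w : 'rV[R]_d).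
Implicit Types (p q g h : {mpoly F[d]}) (r s : R).

Definition component r p : {mpoly F[d]} :=
  \sum_(mu <- msupp p | wdegree w mu == r) p@_mu *: 'X_[mu].

Lemma mcoeff_component r p mu :
  (component r p)@_mu = if wdegree w mu == r then p@_mu else 0.
Proof.
rewrite raddf_sum /=.
have [mup|nmup] := boolP (mu \in msupp p); last first.
  rewrite (memN_msupp_eq0 nmup) if_same big_seq_cond big1 // => nu /andP[nup _].
  rewrite mcoeffZ mcoeffX; have [eq_nu|] := eqVneq nu mu; last by rewrite mulr0.
  by rewrite -eq_nu nup in nmup.
rewrite big_mkcond (bigD1_seq mu) //= ?msupp_uniq // big1 ?addr0 => [|nu nnu].
  by case: ifP => _; rewrite ?mcoeff0 // mcoeffZ mcoeffX eqxx mulr1.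
by case: ifP => _; rewrite ?mcoeff0 // mcoeffZ mcoeffX (negPf nnu) mulr0.
Qed.

Lemma componentD r p q : component r (p + q) = component r p + component r q.
Proof.
apply/mpolyP => mu; rewrite mcoeffD !mcoeff_component mcoeffD.
by case: ifP; rewrite ?addr0.
Qed.

Lemma component0 r : component r 0 = 0.
Proof. by apply/mpolyP => mu; rewrite mcoeff_component mcoeff0 if_same. Qed.

Lemma component_homog r p :
  (forall mu, mu \in msupp p -> wdegree w mu = r) -> component r p = p.
Proof.
move=> hp; apply/mpolyP => mu; rewrite mcoeff_component; case: ifPn => // /eqP nr.
by apply/esym/memN_msupp_eq0/negP => /hp.
Qed.

Lemma component_disjoint r p :
  (forall mu, mu \in msupp p -> wdegree w mu != r) -> component r p = 0.
Proof.
move=> hp; apply/mpolyP => mu; rewrite mcoeff_component mcoeff0; case: ifPn => // /eqP er.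
by apply/memN_msupp_eq0/negP => /hp; rewrite er eqxx.
Qed.

Lemma msupp_component r p mu :
  mu \in msupp (component r p) -> wdegree w mu = r /\ mu \in msupp p.
Proof.
rewrite !mcoeff_msupp mcoeff_component; case: ifP => [/eqP-> //|_].
by rewrite eqxx.
Qed.

Lemma componentM r s g h : (forall mu, mu \in msupp g -> wdegree w mu = s) ->
  component (r + s) (h * g) = component r h * g.
Proof.
move=> hg; rewrite -[h in LHS](subrK (component r h)) mulrDl componentD.
rewrite component_disjoint ?add0r => [|mu /msuppM_le/allpairsP[[m1 m2] /= [h1 h2 ->]]].
  apply: component_homog => mu /msuppM_le/allpairsP[[m1 m2] /= [h1 h2 ->]].
  by rewrite wdegreeD (hg _ h2); have [-> _] := msupp_component h1.
rewrite wdegreeD (hg _ h2) (inj_eq (addIr s)); apply/eqP => e1.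
by move: h1; rewrite mcoeff_msupp mcoeffB mcoeff_component e1 eqxx subrr eqxx.
Qed.

Lemma min_weight p : p != 0 -> exists2 mu, mu \in msupp p &
  forall nu, nu \in msupp p -> wdegree w mu <= wdegree w nu.
Proof.
rewrite -msupp_eq0 => p0; apply: seq_min p0 => [mu nu|l mu nu].
  exact/orP/le_total.
exact: le_trans.
Qed.

Lemma initial_form0 : initial_form w (0 : {mpoly F[d]}) = 0.
Proof. by rewrite /initial_form msupp0 big_nil. Qed.

Lemma initial_formE p mu : mu \in msupp p ->
  (forall nu, nu \in msupp p -> wdegree w mu <= wdegree w nu) ->
  initial_form w p = component (wdegree w mu) p.
Proof.
move=> mup hmu; rewrite /initial_form big_seq_cond [RHS]big_seq_cond.
apply: eq_bigl => nu; have [nup /=|//] := boolP (nu \in msupp p).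
apply/allP/eqP => [h|-> //].
by apply/eqP; rewrite eq_le hmu // h.
Qed.

Lemma initial_form_monomial p mu : mu \in msupp p ->
  (forall l, l \in msupp p -> wdegree w mu < wdegree w l \/ l = mu) ->
  initial_form w p = p@_mu *: 'X_[mu].
Proof.
move=> mup hmin; rewrite (initial_formE mup) => [|l /hmin[/ltW//|->//]].
apply/mpolyP => l; rewrite mcoeff_component mcoeffZ mcoeffX.
have [<-|nl] := eqVneq mu l; first by rewrite eqxx mulr1.
rewrite mulr0; case: ifP => // /eqP el; apply/memN_msupp_eq0/negP => /hmin[].
  by rewrite el ltxx.
by move=> el'; rewrite el' eqxx in nl.
Qed.

Lemma component_initial_ideal (J : set {mpoly F[d]}) r (s : seq ({mpoly F[d]} * {mpoly F[d]})) :
  J 0 -> (forall p q, J p -> J q -> J (p + q)) -> (forall h p, J p -> J (h * p)) ->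
  (forall u, u \in s -> [set initial_form w p | p in J] u.2) ->
  exists P, [/\ J P, forall nu, nu \in msupp P -> r <= wdegree w nu &
    component r P = component r (\sum_(u <- s) u.1 * u.2)].
Proof.
move=> J0 JD JM; elim: s => [|[h g] s IHs] hs.
  by exists 0; split=> //; rewrite ?msupp0 // big_nil.
have [P [JP rP eP]] : exists P, [/\ J P, forall nu, nu \in msupp P -> r <= wdegree w nu &
    component r P = component r (\sum_(u <- s) u.1 * u.2)].
  by apply: IHs => u us; apply: hs; rewrite inE us orbT.
have [p Jp /= ep] := hs (h, g) (mem_head _ _).
rewrite big_cons /= componentD -eP.
have [p0|/min_weight[mu mup hmu]] := eqVneq p 0.
  by exists P; split=> //; rewrite -ep p0 initial_form0 mulr0 component0 add0r.
have e : r = (r - wdegree w mu) + wdegree w mu by rewrite subrK.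
exists (component (r - wdegree w mu) h * p + P); split.
- by apply: JD => //; apply: JM.
- move=> nu /msuppD_le; rewrite mem_cat => /orP[|/rP//].
  move=> /msuppM_le/allpairsP[[m1 m2] /= [/msupp_component[e1 _] h2 ->]].
  by rewrite wdegreeD e1 {1}e lerD2l hmu.
rewrite componentD; congr (_ + _).
rewrite -ep (initial_formE mup hmu); set t := r - _ in e *.
rewrite e [RHS]componentM => [|nu /msupp_component[//]].
by rewrite mulrC [t + _]addrC componentM 1?mulrC // => nu /msupp_component[].
Qed.

End WeightComponents.

Lemma frac_denominator (D : idomainType) (x : {fraction D}) :
  exists2 b, b != 0 & exists c, tofrac b * x = tofrac c.
Proof.
elim/quotW: x => x; exists (frac x).2; first exact: denom_ratioP.
exists (frac x).1; unlock tofrac; rewrite -[LHS]FracField.pi_mul /FracField.mulf.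
apply/eqmodP; rewrite /= FracField.equivfE.
rewrite !numden_Ratio ?oner_eq0 ?mulf_neq0 ?oner_eq0 ?denom_ratioP //.
by rewrite mul1r mulr1 mulrC.
Qed.

Section IdealSpan.
Variables (A : comNzRingType) (G : set A).

Lemma ideal_span0 : ideal_span G 0.
Proof. by exists [::]; rewrite big_nil. Qed.

Lemma ideal_span_gen g : G g -> ideal_span G g.
Proof.
move=> Gg; exists [:: (1, g)]; split=> [u|]; last by rewrite big_seq1 mul1r.
by rewrite inE => /eqP->.
Qed.

Lemma ideal_spanD p q : ideal_span G p -> ideal_span G q -> ideal_span G (p + q).
Proof.
move=> [s [Gs ->]] [t [Gt ->]]; exists (s ++ t); rewrite big_cat; split=> // u.
by rewrite mem_cat => /orP[/Gs|/Gt].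
Qed.

Lemma ideal_spanM h p : ideal_span G p -> ideal_span G (h * p).
Proof.
move=> [s [Gs ->]]; exists [seq (h * u.1, u.2) | u <- s]; split.
  by move=> _ /mapP[u us ->]; apply: (Gs u us).
by rewrite big_map mulr_sumr; apply: eq_bigr => u _; rewrite mulrA.
Qed.

End IdealSpan.

Lemma initial_ideal_monomial (R : realType) (F : fieldType) (d : nat) (w : 'rV[R]_d)
    (J : set {mpoly F[d]}) p mu : J p -> mu \in msupp p ->
  (forall l, l \in msupp p -> wdegree w mu < wdegree w l \/ l = mu) ->
  initial_ideal w J 'X_[mu].
Proof.
move=> Jp mup hmin; have c0 : p@_mu != 0 by rewrite -mcoeff_msupp.
have -> : 'X_[mu] = (p@_mu)^-1%:MP * initial_form w p :> {mpoly F[d]}.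
  by rewrite (initial_form_monomial mup hmin) mul_mpolyC scalerA mulVf // scale1r.
by apply/ideal_spanM/ideal_span_gen; exists p.
Qed.

(** * Specialization of coefficients *)

Section Specialization.
Variables (C : fieldType) (E M : nat) (emb : 'I_E -> 'I_M).
Hypothesis emb_inj : injective emb.
Variables (K : fieldType) (tofield : {rmorphism {mpoly C[E]} -> K}).
Hypothesis tofield_inj : injective tofield.
Hypothesis tofield_denominator :
  forall x, exists2 b, b != 0 & exists c, tofield b * x = tofield c.

Definition param_const (z : C) : K := tofield z%:MP.

Lemma param_const_is_zmod_morphism : zmod_morphism param_const.
Proof. by move=> x y; rewrite /param_const mpolyCB rmorphB. Qed.

Lemma param_const_is_monoid_morphism : monoid_morphism param_const.
Proof.
split=> [|x y]; first by rewrite /param_const mpolyC1 rmorph1.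
by rewrite /param_const mpolyCM rmorphM.
Qed.

HB.instance Definition _ :=
  GRing.isZmodMorphism.Build C K param_const param_const_is_zmod_morphism.
HB.instance Definition _ :=
  GRing.isMonoidMorphism.Build C K param_const param_const_is_monoid_morphism.

Lemma tofield_eq0 b : (tofield b == 0) = (b == 0).
Proof. by rewrite -(rmorph0 tofield) (inj_eq tofield_inj). Qed.

Definition subst (t : 'I_M) : {mpoly K[M]} :=
  if [pick u | emb u == t] is Some u then (tofield 'X_u)%:MP else 'X_t.

Definition specialized_part (l : 'X_{1..M}) : 'X_{1..E} := [multinom l (emb u) | u < E].

Definition free_part (l : 'X_{1..M}) : 'X_{1..M} :=
  [multinom if t \in codom emb then 0%N else l t | t < M].

Lemma parts_inj l l' :
  specialized_part l = specialized_part l' -> free_part l = free_part l' -> l = l'.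
Proof.
move=> /mnmP es /mnmP ef; apply/mnmP => t.
have [/codomP[u ->]|nt] := boolP (t \in codom emb).
  by have := es u; rewrite !mnmE.
by have := ef t; rewrite !mnmE (negPf nt).
Qed.

Lemma subst_emb u : subst (emb u) = (tofield 'X_u)%:MP.
Proof.
rewrite /subst; case: pickP => [v /eqP/emb_inj->//|/(_ u)].
by rewrite eqxx.
Qed.

Lemma subst_free t : t \notin codom emb -> subst t = 'X_t.
Proof.
move=> nt; rewrite /subst; case: pickP => // u /eqP e.
by rewrite -e codom_f in nt.
Qed.

Lemma mmap1_subst l :
  mmap1 subst l =
  (tofield 'X_[specialized_part l])%:MP * 'X_[free_part l].
Proof.
rewrite /mmap1 (bigID (mem (codom emb))) /=; congr (_ * _).
  rewrite -big_uniq /=; last by rewrite map_inj_uniq ?enum_uniq.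
  rewrite big_map big_enum /= mpolyXE_id !rmorph_prod; apply: eq_bigr => u _.
  by rewrite subst_emb mnmE !rmorphXn.
rewrite mpolyXE_id [RHS](bigID (mem (codom emb))) /= [X in _ = X * _]big1 ?mul1r.
  by apply: eq_bigr => t nt; rewrite subst_free // mnmE (negPf nt).
by move=> t ct; rewrite mnmE ct expr0.
Qed.

Lemma mcoeff_mmap_subst (F : nzRingType) (g : {rmorphism F -> K}) (p : {mpoly F[M]}) rho :
  (mmap (@mpolyC M K \o g) subst p)@_rho =
  \sum_(l <- msupp p | free_part l == rho) g p@_l * tofield 'X_[specialized_part l].
Proof.
rewrite /mmap raddf_sum [RHS]big_mkcond /=; apply: eq_bigr => l _.
rewrite mmap1_subst mulrA -mpolyCM mcoeffCM mcoeffX.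
by case: eqP; rewrite ?mulr1 ?mulr0.
Qed.

Definition theta : {mpoly C[M]} -> {mpoly K[M]} := mmap (@mpolyC M K \o param_const) subst.
Definition sigma : {mpoly K[M]} -> {mpoly K[M]} := mmap (@mpolyC M K \o idfun) subst.

HB.instance Definition _ := GRing.RMorphism.on theta.
HB.instance Definition _ := GRing.RMorphism.on sigma.

Lemma thetaC c : theta c%:MP = (param_const c)%:MP.
Proof. exact: mmapC. Qed.

Lemma thetaX l : theta 'X_[l] = mmap1 subst l.
Proof. exact: mmapX. Qed.

Lemma thetaXU t : theta 'X_t = subst t.
Proof. by rewrite thetaX mmap1U. Qed.

Lemma sigmaC c : sigma c%:MP = c%:MP.
Proof. exact: mmapC. Qed.

Lemma sigmaX l : sigma 'X_[l] = mmap1 subst l.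
Proof. exact: mmapX. Qed.

Lemma sigmaXU t : sigma 'X_t = subst t.
Proof. by rewrite sigmaX mmap1U. Qed.

Lemma sigma_map_mpoly p : sigma (map_mpoly param_const p) = theta p.
Proof.
elim/mpolyind: p => [|c l p _ _ IHp]; first by rewrite !rmorph0.
rewrite -mul_mpolyC !(rmorphD, rmorphM) /= IHp.
by rewrite map_mpolyC map_mpolyX sigmaC sigmaX thetaC thetaX.
Qed.

(* The gamma's are algebraically independent, so the monomials of Q with the same
   free part cannot cancel. *)
Lemma theta_mcoeff_neq0 Q l : l \in msupp Q -> (theta Q)@_(free_part l) != 0.
Proof.
move=> lQ; rewrite /theta mcoeff_mmap_subst.
pose G : {mpoly C[E]} := \sum_(l' <- msupp Q | free_part l' == free_part l)
   Q@_l' *: 'X_[specialized_part l'].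
rewrite (_ : \sum_(_ <- _ | _) _ = tofield G); last first.
  rewrite rmorph_sum; apply: eq_bigr => l' _.
  by rewrite /= -mul_mpolyC rmorphM.
rewrite tofield_eq0; apply/eqP => /(congr1 (mcoeff (specialized_part l))).
rewrite mcoeff0 raddf_sum /= big_mkcond (bigD1_seq l) ?msupp_uniq //= eqxx.
rewrite mcoeffZ mcoeffX eqxx mulr1 big1 ?addr0 => [e0|l' nl].
  by move: lQ; rewrite mcoeff_msupp e0 eqxx.
case: eqP => // ef; rewrite mcoeffZ mcoeffX; case: eqP; last by rewrite mulr0.
by move=> es; case/eqP: nl; apply: parts_inj.
Qed.

Lemma msupp_mmap_subst (F : nzRingType) (g : {rmorphism F -> K}) (p : {mpoly F[M]}) rho :
  rho \in msupp (mmap (@mpolyC M K \o g) subst p) ->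
  exists2 l, l \in msupp p & free_part l = rho.
Proof.
rewrite mcoeff_msupp mcoeff_mmap_subst => n0; apply: contrapT => nex.
case/eqP: n0; rewrite big_seq_cond big1 // => l /andP[lp /eqP el].
by case: nex; exists l.
Qed.

Variable I : set {mpoly C[M]}.
Hypothesis I0 : I 0.
Hypothesis ID : forall p q, I p -> I q -> I (p + q).
Hypothesis IM : forall h p, I p -> I (h * p).

Definition spec_ideal : set {mpoly K[M]} :=
  ideal_span ([set map_mpoly param_const p | p in I] `|`
    [set q | exists u, q = 'X_(emb u) - (tofield 'X_u)%:MP]).

Local Notation J := spec_ideal.

Lemma spec_idealN p : J p -> J (- p).
Proof. by move=> Jp; rewrite -mulN1r; apply: ideal_spanM. Qed.

Lemma sigma_congr h : J (sigma h - h).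
Proof.
have mulc f g : J (sigma f - f) -> J (sigma g - g) -> J (sigma (f * g) - f * g).
  move=> Jf Jg; rewrite rmorphM.
  have -> : sigma f * sigma g - f * g = sigma f * (sigma g - g) + g * (sigma f - f) by ring.
  by apply: ideal_spanD; apply: ideal_spanM.
have one : J (sigma 1 - 1) by rewrite rmorph1 subrr; apply: ideal_span0.
elim/mpolyind: h => [|c l p _ _ Jp]; first by rewrite rmorph0 subrr; apply: ideal_span0.
rewrite rmorphD opprD addrACA; apply: ideal_spanD => //.
rewrite -mul_mpolyC; apply: (mulc) => //.
  by rewrite sigmaC subrr; apply: ideal_span0.
rewrite mpolyXE_id; elim/big_ind: _ => // t _.
elim: (l t) => [|e IHe]; rewrite ?expr0 // exprS; apply: (mulc) => //.
rewrite sigmaXU; have [/codomP[u ->]|nt] := boolP (t \in codom emb).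
  rewrite subst_emb -opprB; apply/spec_idealN/ideal_span_gen.
  by right; exists u.
by rewrite subst_free // subrr; apply: ideal_span0.
Qed.

Lemma theta_spec_ideal Q : I Q -> J (theta Q).
Proof.
move=> IQ; rewrite -sigma_map_mpoly -(subrK (map_mpoly param_const Q) (sigma _)).
apply: ideal_spanD; first exact: sigma_congr.
by apply: ideal_span_gen; left; exists Q.
Qed.

Definition kappa : {mpoly C[E]} -> {mpoly C[M]} :=
  mmap (@mpolyC M C) (fun u => 'X_(emb u)).

HB.instance Definition _ := GRing.RMorphism.on kappa.

Lemma theta_kappa b : theta (kappa b) = (tofield b)%:MP.
Proof.
elim/mpolyind: b => [|c l p _ _ IHp]; first by rewrite !rmorph0.
rewrite -mul_mpolyC !(rmorphD, rmorphM) /= IHp; congr (_ * _ + _).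
  by rewrite [kappa c%:MP]mmapC thetaC.
rewrite [kappa 'X_[l]]mmapX rmorph_prod [in RHS]mpolyXE_id !rmorph_prod.
by apply: eq_bigr => u _; rewrite !rmorphXn /= thetaXU subst_emb.
Qed.

Lemma clear_denominators h :
  exists2 b : {mpoly C[E]}, b != 0 & exists H, (tofield b)%:MP * sigma h = theta H.
Proof.
elim/mpolyind: h => [|c l p _ _ [b b0 [H eH]]].
  by exists 1; rewrite ?oner_eq0 //; exists 0; rewrite !rmorph0 mulr0.
have [d d0 [e ed]] := tofield_denominator c.
exists (b * d); first exact: mulf_neq0.
exists (kappa b * (kappa e * 'X_[l]) + kappa d * H).
rewrite -mul_mpolyC !(rmorphD, rmorphM) /= !theta_kappa -eH -ed thetaX sigmaC sigmaX.
rewrite rmorphM /=; ring.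
Qed.

Lemma spec_ideal_clear p : J p ->
  exists2 b : {mpoly C[E]}, b != 0 & exists2 Q, I Q & (tofield b)%:MP * sigma p = theta Q.
Proof.
case=> s [Gs ->]; elim: s Gs => [|[h g] s IHs] Gs.
  by exists 1; rewrite ?oner_eq0 //; exists 0; rewrite // big_nil !rmorph0 mulr0.
have [b b0 [Q IQ eQ]] : exists2 b : {mpoly C[E]}, b != 0 & exists2 Q, I Q &
    (tofield b)%:MP * sigma (\sum_(u <- s) u.1 * u.2) = theta Q.
  by apply: IHs => u us; apply: Gs; rewrite inE us orbT.
rewrite big_cons; have /= := Gs (h, g) (mem_head _ _); case=> [[q Iq <-]|[u ->]].
  have [d d0 [H eH]] := clear_denominators h.
  exists (b * d); first exact: mulf_neq0.
  exists (kappa b * (H * q) + kappa d * Q).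
    by apply: ID; apply: IM => //; apply: IM.
  rewrite !(rmorphD, rmorphM) /= !theta_kappa -eH -eQ sigma_map_mpoly; ring.
exists b => //; exists Q => //.
by rewrite rmorphD rmorphM rmorphB /= sigmaXU sigmaC subst_emb subrr mulr0 add0r.
Qed.

Variables (R : realType) (w : 'rV[R]_M).
Hypothesis w_emb : forall u, w ord0 (emb u) = 0.

Lemma wdegree_free l : wdegree w (free_part l) = wdegree w l.
Proof.
apply: eq_bigr => t _; rewrite mnmE; case: ifP => // /codomP[u ->].
by rewrite w_emb !mul0r.
Qed.

Lemma initial_ideal_monomialP :
  (exists mu, initial_ideal w J 'X_[mu]) <->
  (exists Q nu, [/\ I Q, nu \in msupp Q & forall l, l \in msupp Q ->
     wdegree w nu < wdegree w l \/ free_part l = free_part nu]).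
Proof.
split=> [[mu [s [Gs es]]]|[Q [nu [IQ nuQ hQ]]]]; last first.
  exists (free_part nu).
  apply: (initial_ideal_monomial (theta_spec_ideal IQ)).
    by rewrite mcoeff_msupp theta_mcoeff_neq0.
  move=> _ /msupp_mmap_subst[l /hQ h <-].
  by rewrite !wdegree_free; case: h => ->; [left|right].
have [||||P [JP rP eP]] := @component_initial_ideal R _ M w J (wdegree w mu) s.
- exact: ideal_span0.
- by move=> p q; apply: ideal_spanD.
- by move=> h p; apply: ideal_spanM.
- exact: Gs.
have {}eP : component w (wdegree w mu) P = 'X_[mu].
  rewrite eP -es; apply: component_homog => l.
  by rewrite msuppX inE => /eqP->.
have supp_r l : l \in msupp P -> wdegree w l = wdegree w mu -> l = mu.
  move=> lP el; apply/eqP; have : l \in msupp (component w (wdegree w mu) P).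
    by rewrite mcoeff_msupp mcoeff_component el eqxx -mcoeff_msupp.
  by rewrite eP msuppX inE.
have Pmu : P@_mu = 1.
  by have := congr1 (mcoeff mu) eP; rewrite mcoeff_component eqxx mcoeffX eqxx.
have [b b0 [Q IQ eQ]] := spec_ideal_clear JP.
have suppQ l : l \in msupp Q -> exists2 l', l' \in msupp P & free_part l' = free_part l.
  move=> /theta_mcoeff_neq0; rewrite -eQ mcoeffCM mulf_eq0 negb_or => /andP[_].
  by rewrite -mcoeff_msupp => /msupp_mmap_subst.
have [nu nuQ enu] : exists2 nu, nu \in msupp Q & free_part nu = free_part mu.
  apply: (@msupp_mmap_subst _ param_const).
  rewrite -/(theta Q) -eQ mcoeff_msupp mcoeffCM mulf_neq0 ?tofield_eq0 //.
  rewrite mcoeff_mmap_subst big_mkcond.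
  rewrite (bigD1_seq mu) ?msupp_uniq ?mcoeff_msupp ?Pmu ?oner_eq0 //= eqxx.
  rewrite big_seq_cond big1 ?addr0 => [|l /andP[lP /eqP nl]].
    rewrite mul1r tofield_eq0; apply/eqP => /(congr1 (mcoeff (specialized_part mu))).
    by rewrite mcoeffX eqxx mcoeff0 => /eqP; rewrite oner_eq0.
  case: eqP => // el.
  by case: nl; apply: supp_r => //; rewrite -wdegree_free el wdegree_free.
exists Q, nu; split=> // l /suppQ[l' l'P el].
have := rP l' l'P; rewrite -(wdegree_free l') el wdegree_free le_eqVlt => /orP[/eqP e|lt].
  right; rewrite enu -el (supp_r l') //.
  by rewrite -wdegree_free el wdegree_free e.
by left; rewrite -wdegree_free enu wdegree_free.
Qed.

End Specialization.

(** * Stable intersection *)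

Section Stable.
Variables (R : realType) (n k : nat) (m : 'I_k -> nat).
Variable a : forall i : 'I_k, 'I_(m i) -> 'rV[int]_n.
Variable S : forall i : 'I_k, {set 'I_(m i)}.
Local Notation M := (\sum_i m i)%N.
Local Notation E := (\sum_i #|S i|)%N.

Definition specialized_index : 'I_E -> 'I_M :=
  block_fun (fun i (t : 'I_#|S i|) => tagnat.Rank i (enum_val t)).

Local Notation emb := specialized_index.

Lemma specialized_index_Rank i (t : 'I_#|S i|) :
  emb (tagnat.Rank i t) = tagnat.Rank i (enum_val t).
Proof. exact: block_funE. Qed.

Lemma specialized_index_inj : injective emb.
Proof.
move=> u u'; have [i [t ->]] := Rank_surj u; have [i' [t' ->]] := Rank_surj u'.
rewrite !specialized_index_Rank => /(can_inj tagnat.rankK) e.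
have ei : i = i' by case: e.
move: t' e; rewrite -ei => t' /eqP; rewrite eq_Tagged /= => /eqP/enum_val_inj->.
by [].
Qed.

Lemma specialization_subspaceP (w : 'rV[R]_M) :
  specialization_subspace S w <-> forall u, w ord0 (emb u) = 0.
Proof.
split=> [Sw u|w0 i j jS].
  have [i [t ->]] := Rank_surj u.
  by rewrite specialized_index_Rank; apply/Sw/enum_valP.
have := w0 (tagnat.Rank i (enum_rank_in jS j)).
by rewrite specialized_index_Rank enum_rankK_in.
Qed.

Definition parameter_embedding : {rmorphism parameter_ring R S -> parameter_field R S} :=
  @tofrac (parameter_ring R S).

Lemma specialized_idealE :
  specialized_ideal R a S = spec_ideal emb parameter_embedding (resultant_ideal R a).
Proof.
rewrite /specialized_ideal /spec_ideal; congr (ideal_span (_ `|` _)).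
apply/seteqP; split=> [_ [i [t ->]]|_ [u ->]] /=.
  by exists (tagnat.Rank i t); rewrite specialized_index_Rank.
have [i [t ->]] := Rank_surj u.
by exists i, t; rewrite specialized_index_Rank.
Qed.

Lemma resultant_idealD p q : resultant_ideal R a p -> resultant_ideal R a q ->
  resultant_ideal R a (p + q).
Proof. by move=> Ip Iq c Zc; rewrite mevalD Ip // Iq // addr0. Qed.

Lemma resultant_idealM h p : resultant_ideal R a p -> resultant_ideal R a (h * p).
Proof. by move=> Ip c Zc; rewrite mevalM Ip // mulr0. Qed.

Lemma resultant_ideal0 : resultant_ideal R a 0.
Proof. by move=> c _; rewrite meval0. Qed.

Lemma specialized_initial_monomialP (w : 'rV[R]_M) : (forall u, w ord0 (emb u) = 0) ->
  (exists mu, initial_ideal w (specialized_ideal R a S) 'X_[mu]) <->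
  (exists Q nu, [/\ resultant_ideal R a Q, nu \in msupp Q &
     forall l, l \in msupp Q ->
       wdegree w nu < wdegree w l \/ free_part emb l = free_part emb nu]).
Proof.
move=> w0; rewrite specialized_idealE.
apply: (initial_ideal_monomialP specialized_index_inj) => //.
- by move=> b c /eqP; rewrite tofrac_eq => /eqP.
- exact: frac_denominator.
- exact: resultant_ideal0.
- exact: resultant_idealD.
- exact: resultant_idealM.
Qed.

Lemma link_specialization_subspace (w u : 'rV[R]_M) :
  specialization_subspace S w ->
  link (specialization_subspace S) w u <-> specialization_subspace S u.
Proof.
move=> Sw; split=> [[d d0 hd] i j jS|Su].
  have := hd (d / 2) _ i j jS; rewrite !mxE (Sw i j jS) add0r.
  have -> : 0 < d / 2 < d by rewrite divr_gt0 // ltr_pdivrMr // ltr_pMr ?ltr1n.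
  by move=> /(_ isT)/eqP; rewrite mulf_eq0 gt_eqF ?divr_gt0 // => /eqP.
by exists 1 => // e _ i j jS; rewrite !mxE Sw // Su // mulr0 addr0.
Qed.

Lemma stable_sub_tropicalization (w : 'rV[R]_M) :
  specialized_tropical_resultant R a S w -> tropicalization R (specialized_ideal R a S) w.
Proof.
move=> [[TRw Sw] st]; have /specialization_subspaceP w0 := Sw.
move=> /(specialized_initial_monomialP w0) [Q [nu [IQ nuQ hQ]]].
pose N (l : 'X_{1..M}) : R := \sum_(t | t \in codom emb) (l t)%:R ^+ 2.
pose L := [seq l <- msupp Q | wdegree w l == wdegree w nu].
have [||| l0 l0L Nmax] := @seq_min _ (fun l l' => N l' <= N l) L.
- by move=> x y; apply/orP/le_total.
- by move=> y x z xy yz; apply: le_trans xy.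
- have : nu \in L by rewrite mem_filter eqxx.
  by case: (L).
move: l0L; rewrite mem_filter => /andP[/eqP l0w l0Q].
have free l : l \in msupp Q -> wdegree w l = wdegree w nu -> free_part emb l = free_part emb nu.
  by move=> lQ e; case: (hQ l lQ) => //; rewrite e ltxx.
(* By Cauchy-Schwarz, - l0 is minimized over L at l0 only, as l0 has largest norm. *)
pose v : 'rV[R]_M := \row_t (- (l0 t)%:R).
have : minkowski_sub (link (tropical_resultant R a) w) (link (specialization_subspace S) w) v.
  by rewrite st.
case=> u [d d0 hd] [y /(link_specialization_subspace _ Sw)/specialization_subspaceP y0 euv].
have uT t : t \in codom emb -> u ord0 t = - (l0 t)%:R.
  case/codomP => s es; have := congr1 (fun z : 'rV[R]_M => z ord0 t) euv.
  by rewrite !mxE es y0 oppr0 addr0.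
have umin l : l \in msupp Q -> l != l0 -> wdegree w l = wdegree w nu ->
    wdegree u l0 < wdegree u l.
  move=> lQ nl lw; have efree := etrans (free l lQ lw) (esym (free l0 l0Q l0w)).
  have freet t : t \notin codom emb -> l t = l0 t.
    by move/mnmP: efree => /(_ t); rewrite !mnmE => + /negPf nt; rewrite nt.
  have Nl : N l <= N l0 by apply: Nmax; rewrite mem_filter lw eqxx.
  have sq : 0 < \sum_(t | t \in codom emb) ((l t)%:R - (l0 t)%:R) ^+ 2 :> R.
    rewrite lt_neqAle eq_sym sumr_ge0 ?andbT => [|t _]; last exact: sqr_ge0.
    apply/eqP => /psumr_eq0P z; case/eqP: nl; apply/mnmP => t.
    have [ct|/freet//] := boolP (t \in codom emb).
    have /eqP := z (fun t _ => sqr_ge0 _) t ct.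
    by rewrite sqrf_eq0 subr_eq0 eqr_nat => /eqP.
  have e : 2 * (wdegree u l - wdegree u l0) =
      \sum_(t | t \in codom emb) ((l t)%:R - (l0 t)%:R) ^+ 2 + (N l0 - N l).
    rewrite -sumrB /N -sumrB -big_split mulr_sumr (bigID (fun t => t \in codom emb)) /=.
    rewrite [X in _ + X]big1 ?addr0 => [|t nt]; last by rewrite freet // subrr mulr0.
    apply: eq_bigr => t ct; rewrite uT //.
    by move: (l t)%:R (l0 t)%:R => x z; ring.
  rewrite -subr_gt0; lra.
have [d' d'0 hd'] : exists2 d', 0 < d' & forall e, 0 < e < d' -> forall l, l \in msupp Q ->
    l != l0 -> wdegree (w + e *: u) l0 < wdegree (w + e *: u) l.
  have wdeg_comb e l : wdegree (w + e *: u) l = wdegree w l + e * wdegree u l.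
    by rewrite mulr_sumr -big_split; apply: eq_bigr => t _; rewrite !mxE mulrDl mulrA.
  have : {subset msupp Q <= msupp Q} by [].
  elim: {1 3}(msupp Q) => [|l K IHK] sub; first by exists 1.
  have [|d1 d10 h1] := IHK; first by move=> l' l'K; apply: sub; rewrite inE l'K orbT.
  have [d2 d20 h2] : exists2 d2, 0 < d2 & forall e, 0 < e < d2 -> l != l0 ->
      wdegree (w + e *: u) l0 < wdegree (w + e *: u) l.
    have lQ := sub l (mem_head _ _).
    have [elw|nlw] := eqVneq (wdegree w l) (wdegree w nu).
      exists 1 => // e /andP[e0 _] nl; rewrite !wdeg_comb l0w elw ltrD2l ltr_pM2l //.
      exact: umin.
    have gap : 0 < wdegree w l - wdegree w l0.
      rewrite subr_gt0 l0w; case: (hQ l lQ) => // ef; case/eqP: nlw.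
      by rewrite -(wdegree_free w0 l) ef wdegree_free.
    have den0 : 0 < 1 + `|wdegree u l - wdegree u l0| by rewrite ltr_wpDr.
    exists ((wdegree w l - wdegree w l0) / (1 + `|wdegree u l - wdegree u l0|)).
      exact: divr_gt0.
    move=> e /andP[e0]; rewrite ltr_pdivlMr // => he _; rewrite !wdeg_comb.
    have := ler_norm (- (wdegree u l - wdegree u l0)); rewrite normrN => hn.
    have := ler_wpM2l (ltW e0) hn; nra.
  exists (Num.min d1 d2); first by rewrite lt_min d10.
  move=> e /andP[e0]; rewrite lt_min => /andP[ed1 ed2] l'.
  rewrite inE => /orP[/eqP->|l'K]; first by apply: h2; rewrite e0.
  by apply: h1 => //; rewrite e0.
pose e := Num.min d d' / 2.
have e0 : 0 < e by rewrite divr_gt0 // lt_min d0.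
have em : e < Num.min d d' by rewrite ltr_pdivrMr // ltr_pMr ?ltr1n // lt_min d0.
move: em; rewrite lt_min => /andP[ed ed'].
apply: (@tropical_resultant_no_strict_min R n k m a (w + e *: u) Q l0) => //.
  by apply: hd; rewrite e0.
by apply: hd'; rewrite e0.
Qed.

End Stable.

(** * Valuations on the solution variety *)

Section Exponents.
Variables (R : realType) (n k : nat) (m : 'I_k -> nat).
Variable a : forall i : 'I_k, 'I_(m i) -> 'rV[int]_n.
Local Notation M := (\sum_i m i)%N.
Local Notation V := ('I_M + 'I_n)%type.

Definition zero_locus := {cx : 'rV[R[i]]_M * 'rV[R[i]]_n | system_zero a cx.1 cx.2}.
Local Notation B := (zero_locus -> R[i]).

Definition coordinate (z : zero_locus) (v : V) : R[i] :=
  match v with inl t => (sval z).1 ord0 t | inr l => (sval z).2 ord0 l end.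

Lemma coordinate_neq0 z v : coordinate z v != 0.
Proof. by case: z v => -[c x] [tc tx _] [t|l] /=; [apply: tc|apply: tx]. Qed.

Definition torus_monomial (D : {ffun V -> int}) : B :=
  fun z => \prod_v coordinate z v ^ D v.

Local Notation mon := torus_monomial.

Lemma torus_monomial0 : mon 0 = 1.
Proof. by apply/funext => z; rewrite /mon big1 // => v _; rewrite ffunE expr0z. Qed.

Lemma torus_monomialD D D' : mon (D + D') = mon D * mon D'.
Proof.
apply/funext => z; rewrite /mon -[RHS]big_split; apply: eq_bigr => v _.
by rewrite ffunE expfzDr // coordinate_neq0.
Qed.

Lemma torus_monomialNr D : mon D * mon (- D) = 1.
Proof. by rewrite -torus_monomialD subrr torus_monomial0. Qed.

Definition term_exponent i (j : 'I_(m i)) : {ffun V -> int} :=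
  [ffun v => match v with inl t => (t == tagnat.Rank i j)%:Z | inr l => a j ord0 l end].

Lemma torus_monomial_term i (j : 'I_(m i)) z :
  mon (term_exponent j) z = (sval z).1 ord0 (tagnat.Rank i j) *
    laurent_monomial (sval z).2 (a j).
Proof.
rewrite /mon big_sumType /=; congr (_ * _); last first.
  by apply: eq_bigr => l _; rewrite ffunE.
rewrite (bigD1 (tagnat.Rank i j)) //= ffunE eqxx expr1z [X in _ * X]big1 ?mulr1 // => t /negPf nt.
by rewrite ffunE nt expr0z.
Qed.

Lemma sum_term i : \sum_(j < m i) mon (term_exponent j) = 0.
Proof.
apply/funext => z; rewrite fct_sumE /=.
have [_ _ /(_ i)] := svalP z; rewrite /system_eval => e0.
by rewrite -[RHS]e0; apply: eq_bigr => j _; rewrite torus_monomial_term.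
Qed.

Lemma pairing_term i (j : 'I_(m i)) (zz : V -> R) :
  pairing (term_exponent j) zz =
  tropical_term a (\row_t zz (inl t)) (\row_l zz (inr l)) j.
Proof.
rewrite /pairing big_sumType /=; congr (_ + _); last first.
  by apply: eq_bigr => l _; rewrite ffunE mxE.
rewrite (bigD1 (tagnat.Rank i j)) //= ffunE eqxx mul1r mxE [X in _ + X]big1 ?addr0 //.
move=> t /negPf nt.
by rewrite ffunE nt mul0r.
Qed.

Lemma tropical_resultant_pairing (j1 j2 : forall i, 'I_(m i)) (zz : V -> R) :
  (forall i, j2 i != j1 i) ->
  (forall i (j : 'I_(m i)), 0 <= pairing (term_exponent j - term_exponent (j1 i)) zz) ->
  (forall i, 0 <= pairing (term_exponent (j1 i) - term_exponent (j2 i)) zz) ->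
  tropical_resultant R a (\row_t zz (inl t)).
Proof.
move=> nj h1 h2; exists (\row_l zz (inr l)) => i; exists (j2 i), (j1 i).
have min1 : attains_min a (\row_t zz (inl t)) (\row_l zz (inr l)) (j1 i).
  by move=> j; rewrite -(pairing_term (j1 i)) -(pairing_term j) -subr_ge0 -pairingN -pairingD.
split=> // j; apply: le_trans (min1 j).
by rewrite -(pairing_term (j1 i)) -(pairing_term (j2 i)) -subr_ge0 -pairingN -pairingD.
Qed.

(* I plays the role of the maximal ideal, and its idealizer of the ring, of a
   valuation on the function ring of the locus of the zeros (c, x): the two terms
   of smallest valuation of each f_i give j1 and j2. *)
Lemma valuation_minima (hm : forall i, (0 < m i)%N) (I : set B) :
  subrng I -> ~ I 1 ->
  exists I' (j1 j2 : forall i, 'I_(m i)),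
   [/\ subrng I', ~ I' 1, I `<=` I', forall i, j2 i != j1 i &
     forall i, (forall j : 'I_(m i), idealizer I' (mon (term_exponent j - term_exponent (j1 i)))) /\
       idealizer I' (mon (term_exponent (j1 i) - term_exponent (j2 i)))].
Proof.
move=> rI nI1.
pose T := {i : 'I_k & 'I_(m i) * 'I_(m i)}%type.
pose y (t : T) : B := mon (term_exponent (tagged t).1 - term_exponent (tagged t).2).
pose y' (t : T) : B := mon (term_exponent (tagged t).2 - term_exponent (tagged t).1).
have yy' t : y t * y' t = 1.
  by rewrite /y /y' -[X in _ * mon X]opprB torus_monomialNr.
have [I' [rI' nI'1 sI _ hI]] := chevalley (enum {: T}) rI nI1 yy'.
have rA := subrng_idealizer rI'; have [_ _ AM] := rA.
have alt i (j j' : 'I_(m i)) :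
    idealizer I' (mon (term_exponent j' - term_exponent j)) \/
    I' (mon (term_exponent j - term_exponent j')).
  by apply: (hI (Tagged _ (j, j'))); rewrite mem_enum.
have exj i : exists jj : 'I_(m i) * 'I_(m i), jj.2 != jj.1 /\
    ((forall j : 'I_(m i), idealizer I' (mon (term_exponent j - term_exponent jj.1))) /\
     idealizer I' (mon (term_exponent jj.1 - term_exponent jj.2))).
  have [|||j1 _ hj1] := @seq_min _
     (fun j j' : 'I_(m i) => idealizer I' (mon (term_exponent j' - term_exponent j)))
     (enum 'I_(m i)).
  - move=> j j'; case: (alt i j j') => [|Ij]; [by left|right].
    exact: sub_idealizer.
  - move=> j' j j'' h h'; rewrite -(subrK (term_exponent j') (term_exponent j'')) -addrA.
    by rewrite torus_monomialD; apply: AM.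
  - by rewrite -size_eq0 size_enum_ord -lt0n.
  have {}hj1 (j : 'I_(m i)) : idealizer I' (mon (term_exponent j - term_exponent j1)).
    by apply: hj1; rewrite mem_enum.
  have [[j2 [nj2 hj2]]|nex] := pselect (exists j2, j2 != j1 /\
      idealizer I' (mon (term_exponent j1 - term_exponent j2))).
    by exists (j1, j2).
  exfalso; apply: nI'1.
  have : \sum_(j < m i) mon (term_exponent j - term_exponent j1) = 0.
    transitivity ((\sum_(j < m i) mon (term_exponent j)) * mon (- term_exponent j1)).
      by rewrite [RHS]big_distrl; apply: eq_bigr => j _; apply: torus_monomialD.
    by rewrite sum_term mul0r.
  rewrite (bigD1 j1) //= subrr torus_monomial0 => /eqP; rewrite addr_eq0 => /eqP->.
  apply: (subrngN rI'); elim/big_ind: _ => [|f g|j nj]; first by case: rI'.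
    exact: subrngD.
  by case: (alt i j j1) => // hj; case: nex; exists j.
exists I', (fun i => (projT1 (cid (exj i))).1), (fun i => (projT1 (cid (exj i))).2).
by split=> // i; case: (cid (exj i)) => jj [].
Qed.

End Exponents.

Section Refined.
Variables (R : realType) (n k : nat) (m : 'I_k -> nat).
Variable a : forall i : 'I_k, 'I_(m i) -> 'rV[int]_n.
Variable S : forall i : 'I_k, {set 'I_(m i)}.
Local Notation M := (\sum_i m i)%N.
Local Notation V := ('I_M + 'I_n)%type.
Local Notation emb := (@specialized_index _ _ S).
Local Notation mon := (@torus_monomial R n k m a).
Local Notation B := (zero_locus R a -> R[i]).
Variables (w v : 'rV[R]_M).
Hypothesis w_emb : forall u, w ord0 (emb u) = 0.

Definition extend0 (q : 'rV[R]_M) (x : V) : R :=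
  if x is inl t then q ord0 t else 0.

(* The exponents of the Laurent monomials in c that are to have positive
   valuation: w refined by v on the specialized coordinates. *)
Definition positive_exponent (D : {ffun V -> int}) : Prop :=
  (forall l, D (inr l) = 0) /\
  (0 < pairing D (extend0 w) \/
   (forall t, t \notin codom emb -> D (inl t) = 0) /\ 0 < pairing D (extend0 v)).

Lemma pairing_extend0 (D : {ffun V -> int}) q :
  pairing D (extend0 q) = \sum_t (D (inl t))%:~R * q ord0 t.
Proof.
rewrite /pairing big_sumType /= [X in _ + X]big1 ?addr0 // => l _.
by rewrite mulr0.
Qed.

Lemma pairing_special (D : {ffun V -> int}) : (forall t, t \notin codom emb -> D (inl t) = 0) ->
  pairing D (extend0 w) = 0.
Proof.
move=> D0; rewrite pairing_extend0 big1 // => t _.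
have [/codomP[u ->]|/D0->] := boolP (t \in codom emb); last by rewrite mul0r.
by rewrite w_emb mulr0.
Qed.

Lemma positive_exponentD D D' :
  positive_exponent D -> positive_exponent D' -> positive_exponent (D + D').
Proof.
move=> [D0 hD] [D'0 hD']; split=> [l|]; first by rewrite ffunE D0 D'0 addr0.
case: hD => [wD|[sD vD]]; case: hD' => [wD'|[sD' vD']].
- by left; rewrite pairingD addr_gt0.
- by left; rewrite pairingD (pairing_special sD') addr0.
- by left; rewrite pairingD (pairing_special sD) add0r.
- right; split=> [t nt|]; first by rewrite ffunE sD // sD' // addr0.
  by rewrite pairingD addr_gt0.
Qed.

Definition positive_span : set B :=
  [set f | exists2 s : seq (R[i] * {ffun V -> int}),
     forall u, u \in s -> positive_exponent u.2 &
     forall z, f z = \sum_(u <- s) u.1 * mon u.2 z].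

Lemma subrng_positive_span : subrng positive_span.
Proof.
split.
- by exists [::] => // z; rewrite big_nil.
- move=> f g [s Ps ef] [s' Ps' eg].
  exists (s ++ [seq (- u.1, u.2) | u <- s']) => [u|z].
    by rewrite mem_cat => /orP[/Ps//|/mapP[u' /Ps' h ->]].
  rewrite big_cat big_map /= -ef; congr (_ + _).
  rewrite [LHS](congr1 -%R (eg z)) -sumrN; apply: eq_bigr => u _.
  by rewrite mulNr.
- move=> f g [s Ps ef] [s' Ps' eg].
  exists [seq (u.1 * u'.1, u.2 + u'.2) | u <- s, u' <- s'] => [u|z].
    by case/allpairsP => -[x y] /= [/Ps h /Ps' h' ->]; apply: positive_exponentD.
  rewrite big_allpairs_dep /= -[LHS]/(f z * g z) ef eg big_distrl; apply: eq_bigr => u _.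
  rewrite big_distrr; apply: eq_bigr => u' _.
  by rewrite torus_monomialD /= mulrACA.
Qed.

Lemma torus_monomial_coef (D : {ffun V -> int}) (c : 'rV[R[i]]_M) (x : 'rV[R[i]]_n)
    (h : system_zero a c x) :
  (forall l, D (inr l) = 0) ->
  mon D (exist _ (c, x) h) = \prod_t c ord0 t ^ D (inl t).
Proof.
move=> D0; rewrite /torus_monomial big_sumType /= [X in _ * X]big1 ?mulr1 // => l _.
by rewrite D0 expr0z.
Qed.

Lemma positive_span1 :
  tropicalization R (specialized_ideal R a S) w -> ~ positive_span 1.
Proof.
move=> tw [s Ps e1]; apply: tw; apply/(specialized_initial_monomialP a w_emb).
pose N := (\sum_(u <- s) \sum_t `|u.2 (inl t)|)%N.
have leN u t : u \in s -> (`|u.2 (inl t)| <= N)%N.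
  move=> us; rewrite /N (big_rem u us) /=; apply: leq_trans (leq_addr _ _).
  by rewrite (bigD1 t) //= leq_addr.
pose nu : 'X_{1..M} := [multinom N | _ < M].
pose mu (D : {ffun V -> int}) : 'X_{1..M} := [multinom `|(N%:Z + D (inl t))%R|%N | t < M].
have muE u t : u \in s -> (mu u.2 t)%:Z = N%:Z + u.2 (inl t).
  move=> us; rewrite mnmE abszE ger0_norm // -lerBlDl sub0r lerNl.
  have := leN u t us; rewrite -lez_nat abszE; apply: le_trans.
  by rewrite -normrN ler_norm.
pose Q : {mpoly R[i][M]} := 'X_[nu] - \sum_(u <- s) u.1 *: 'X_[mu u.2].
have mu_nu u : u \in s -> mu u.2 != nu.
  move=> us; apply/eqP => emu; have [_] := Ps u us.
  have D0 t : u.2 (inl t) = 0.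
    have := muE u t us; rewrite emu mnmE => e.
    by apply: (addrI N%:Z); rewrite -e addr0.
  have p0 q : pairing u.2 (extend0 q) = 0.
    by rewrite pairing_extend0 big1 // => t _; rewrite D0 mul0r.
  by rewrite !p0 ltxx; case=> // -[].
have wmu u q : u \in s -> wdegree q (mu u.2) = wdegree q nu + pairing u.2 (extend0 q).
  move=> us; rewrite pairing_extend0 -big_split; apply: eq_bigr => t _ /=.
  have -> : (mu u.2 t)%:R = (mu u.2 t)%:Z%:~R :> R by [].
  by rewrite muE // rmorphD mnmE mulrDr [X in _ + X]mulrC.
exists Q, nu; split.
- apply/resultant_idealP => c x h; have [tc _ _] := h.
  have := e1 (exist _ (c, x) h).
  rewrite /Q mevalB mevalX (raddf_sum (meval _)) /= => e.
  have -> : \sum_(u <- s) (u.1 *: 'X_[mu u.2]).@[fun t => c ord0 t] =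
     (\prod_t c ord0 t ^+ nu t) * \sum_(u <- s) u.1 * mon u.2 (exist _ (c, x) h).
    rewrite big_distrr big_seq [RHS]big_seq; apply: eq_bigr => u us.
    rewrite mevalZ mevalX [RHS]mulrCA; congr (_ * _).
    rewrite torus_monomial_coef; last by case: (Ps u us).
    rewrite -big_split; apply: eq_bigr => t _ /=.
    by rewrite exprnP muE // expfzDr ?tc // mnmE.
  by rewrite -e mulr1 subrr.
- rewrite mcoeff_msupp mcoeffB mcoeffX eqxx raddf_sum big_seq big1 ?subr0 ?oner_eq0 // => u us.
  by rewrite /= mcoeffZ mcoeffX (negPf (mu_nu u us)) mulr0.
move=> l /msuppB_le; rewrite mem_cat msuppX mem_seq1 => /orP[/eqP->|]; first by right.
move=> /msupp_sum_le/flattenP[_ /mapP[u + ->]]; rewrite mem_filter => /= us.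
move=> /msuppZ_le; rewrite msuppX mem_seq1 => /eqP->.
have [_ [wD|[sD _]]] := Ps u us; first by left; rewrite wmu // ltrDl.
right; apply/mnmP => t; rewrite ![free_part _ _ _]mnmE; case: ifPn => // nt.
by apply/eqP; rewrite -eqz_nat muE // mnmE sD // addr0.
Qed.

End Refined.

Section Directions.
Variables (R : realType) (n k : nat) (m : 'I_k -> nat).
Variable hm : forall i : 'I_k, (2 <= m i)%N.
Variable a : forall i : 'I_k, 'I_(m i) -> 'rV[int]_n.
Variable S : forall i : 'I_k, {set 'I_(m i)}.
Local Notation M := (\sum_i m i)%N.
Local Notation V := ('I_M + 'I_n)%type.
Local Notation emb := (@specialized_index _ _ S).

Lemma tropicalization_weight0 (w : 'rV[R]_M) :
  tropicalization R (specialized_ideal R a S) w -> forall u, w ord0 (emb u) = 0.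
Proof.
move=> tw u; apply: contrapT => /eqP w0; apply: tw.
pose p : {mpoly (parameter_field R S)[M]} :=
  'X_(emb u) - (parameter_embedding R S 'X_u)%:MP.
have Jp : specialized_ideal R a S p.
  by rewrite specialized_idealE; apply: ideal_span_gen; right; exists u.
have pU : p@_U_(emb u) = 1.
  by rewrite mcoeffB mcoeffX mcoeffC eqxx mnm1_eq0 mulr0 subr0.
have p0 : p@_0%MM = - parameter_embedding R S 'X_u.
  by rewrite mcoeffB mcoeffX mcoeffC mnm1_eq0 eqxx mulr1 sub0r.
have supp l : l \in msupp p -> l = U_(emb u)%MM \/ l = 0%MM.
  rewrite mcoeff_msupp mcoeffB mcoeffX mcoeffC => nz.
  have [<-|n1] := eqVneq U_(emb u)%MM l; first by left.
  have [<-|n2] := eqVneq 0%MM l; first by right.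
  by move: nz; rewrite (negPf n1) (eq_sym l) (negPf n2) mulr0 subrr eqxx.
have wU : wdegree w U_(emb u) = w ord0 (emb u).
  rewrite /wdegree (bigD1 (emb u)) //= mnm1E eqxx mulr1 [X in _ + X]big1 ?addr0 // => t.
  by rewrite mnm1E eq_sym => /negPf->; rewrite mulr0.
have w00 : wdegree w 0%MM = 0.
  by rewrite /wdegree big1 // => t _; rewrite mnm0E mulr0.
have [wneg|wpos|weq] := ltrgt0P (w ord0 (emb u)).
- exists 0%MM; apply: (initial_ideal_monomial Jp).
    rewrite mcoeff_msupp p0 oppr_eq0 tofrac_eq0; apply/eqP => /(congr1 (mcoeff U_(u)%MM)).
    by rewrite mcoeffX eqxx mcoeff0 => /eqP; rewrite oner_eq0.
  by move=> l /supp[->|->]; [left; rewrite wU w00|right].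
- exists U_(emb u)%MM; apply: (initial_ideal_monomial Jp).
    by rewrite mcoeff_msupp pU oner_eq0.
  by move=> l /supp[->|->]; [right|left; rewrite wU w00].
- by rewrite weq eqxx in w0.
Qed.

Lemma tropicalization_direction (w v : 'rV[R]_M) :
  tropicalization R (specialized_ideal R a S) w ->
  tropical_resultant R a w /\
  exists u : 'rV[R]_M, (forall s, u ord0 (emb s) = v ord0 (emb s)) /\
    forall e, 0 <= e -> tropical_resultant R a (w + e *: u).
Proof.
move=> tw; have w0 := tropicalization_weight0 tw.
have rI := subrng_positive_span a v w0.
have nI := positive_span1 (v := v) w0 tw.
have [I' [j1 [j2 [rI' nI' sI nj hI]]]] := valuation_minima (fun i => ltnW (hm i)) rI nI.
pose L : seq {ffun V -> int} :=
  [seq term_exponent a j - term_exponent a (j1 i) | i <- enum 'I_k, j <- enum 'I_(m i)] ++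
  [seq term_exponent a (j1 i) - term_exponent a (j2 i) | i <- enum 'I_k].
have LA D : natural_cone L D -> idealizer I' (@torus_monomial R n k m a D).
  elim=> [||D1 D2 _ h1 _ h2]; first by rewrite torus_monomial0; apply: idealizer1.
    move=> D1; rewrite mem_cat => /orP[/allpairsPdep[i [j [_ _ ->]]]|/mapP[i _ ->]].
      by case: (hI i).
    by case: (hI i).
  by rewrite torus_monomialD; case: (subrng_idealizer rI') => _ _; apply.
have LP D : natural_cone L D -> ~ positive_exponent S w v (- D).
  move=> LD PD; apply: nI'; rewrite -(torus_monomialNr R a D); apply: (LA D LD).
  apply: sI; exists [:: (1, - D)] => [u|z]; last by rewrite big_seq1 mul1r.
  by rewrite mem_seq1 => /eqP->.
have TRL (zz : V -> R) : (forall D, D \in L -> 0 <= pairing D zz) ->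
    tropical_resultant R a (\row_t zz (inl t)).
  move=> hzz; apply: (tropical_resultant_pairing nj) => [i j|i]; apply: hzz.
    rewrite mem_cat; apply/orP; left; apply/allpairsPdep; exists i, j.
    by rewrite !mem_enum.
  by rewrite mem_cat; apply/orP; right; apply/mapP; exists i; rewrite ?mem_enum.
have [[z [zw zL]]|[D [LD D0 Dw]]] :=
    farkas_extension (fun x : V => if x is inl _ then true else false) (extend0 w) L; last first.
  case: (LP D LD); split=> [l|]; first by rewrite ffunE (D0 (inr l)) // oppr0.
  by left; rewrite pairingN oppr_gt0.
have [[z' [zv zL']]|[D [LD D0 Dv]]] :=
    farkas_extension (fun x : V => if x is inl t then t \in codom emb else false)
      (extend0 v) L; last first.
  case: (LP D LD); split=> [l|]; first by rewrite ffunE (D0 (inr l)) // oppr0.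
  right; split=> [t nt|]; first by rewrite ffunE (D0 (inl t)) // oppr0.
  by rewrite pairingN oppr_gt0.
have ew (e : R) : w + e *: (\row_t z' (inl t)) = \row_t (z (inl t) + e * z' (inl t)).
  by apply/rowP => t; rewrite !mxE (zw (inl t)).
have TRe e : 0 <= e -> tropical_resultant R a (w + e *: (\row_t z' (inl t))).
  move=> e0; rewrite ew; apply: (TRL (fun x => z x + e * z' x)) => D LD.
  by rewrite pairing_comb addr_ge0 ?mulr_ge0 ?zL ?zL'.
split; first by have := TRe 0 (lexx 0); rewrite scale0r addr0.
exists (\row_t z' (inl t)); split=> // s.
by rewrite mxE (zv (inl (emb s))) // codom_f.
Qed.

Lemma tropicalization_sub_stable (w : 'rV[R]_M) :
  tropicalization R (specialized_ideal R a S) w -> specialized_tropical_resultant R a S w.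
Proof.
move=> tw; have [TRw _] := tropicalization_direction 0 tw.
have Sw : specialization_subspace S w.
  exact/specialization_subspaceP/(tropicalization_weight0 tw).
split=> //; apply/seteqP; split=> // v _.
have [_ [u [uv hu]]] := tropicalization_direction v tw.
exists u; first by exists 1 => // e /andP[/ltW e0 _]; apply: hu.
exists (u - v); last by rewrite opprB addrC subrK.
apply/(link_specialization_subspace _ Sw)/specialization_subspaceP => s.
by rewrite !mxE uv subrr.
Qed.

End Directions.

Theorem proposition3p9 (R : realType) (n k : nat) (m : 'I_k -> nat)
    (hm : forall i : 'I_k, (2 <= m i)%N)
    (a : forall i : 'I_k, 'I_(m i) -> 'rV[int]_n)
    (S : forall i : 'I_k, {set 'I_(m i)}) :
  tropicalization R (specialized_ideal R a S)
  = specialized_tropical_resultant R a S.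
Proof.
apply/seteqP; split=> w.
  exact: (tropicalization_sub_stable hm).
exact: stable_sub_tropicalization.
Qed.
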